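(* Let $v,w$ be weights on $(0,\infty)$, let $p\in[1,\infty)$ and $q\in(0,\infty)$. For $t\in(0,\infty)$, denote $$V(t)=\begin{cases}\left(\int_{0}^{t}v(s)^{1-p'}\,ds\right)^{\frac1{p'}} & \text{if } p\in(1,\infty),\\[4pt] \operatorname*{ess\,sup}_{s\in(0,t)}\dfrac{1}{v(s)} & \text{if } p=1,\end{cases}\qquad\text{and}\qquad W(t)=\int_{t}^{\infty}w(s)\,ds .$$ Then there exists a positive constant $C$ such that $$\left(\int_{0}^{\infty}\left(\int_{0}^{t}f(s)\,ds\right)^{q}w(t)\,dt\right)^{\frac1q}\le C\left(\int_{0}^{\infty}f(t)^{p}v(t)\,dt\right)^{\frac1p}$$ holds for every nonnegative measurable function $f$ on $(0,\infty)$ if and only if $A<\infty$, where $$A=\begin{cases}\sup\limits_{t\in(0,\infty)}V(t)\,W(t)^{\frac1q} & \text{if } p\le q,\\[6pt] \displaystyle\int_{0}^{\infty}W^{\frac{p}{p-q}}\,dV^{\frac{pq}{p-q}} & \text{if } p>q,\end{cases}$$ in which the latter integral should be understood in the Lebesgue--Stieltjes sense with respect to the (monotone) function $V^{\frac{pq}{p-q}}$.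
   Context: Weights on $(0,\infty)$ are nonnegative measurable functions on $(0,\infty)$. The conjugate exponent $p'$ of $p$ is defined by $\frac1p+\frac1{p'}=1$. The constant $C$ is independent of $f$.
   Formalization: For p > q the Stieltjes integral is taken over [0,∞) with V(0)=0, so V(0+)>0 gives an atom at 0; without it the claim fails (p=1, q=1/2, v=w=1). Where V is infinite, the integral is the limit over truncations of V^{pq/(p-q)}. *)

(* Defs.v *)
From HB Require Import structures.
From mathcomp Require Import all_boot all_order all_algebra.
From mathcomp Require Import all_classical all_reals all_analysis.
From mathcomp Require Import ess_sup_inf.

Set Implicit Arguments.
Unset Strict Implicit.
Unset Printing Implicit Defensive.
Import Order.TTheory GRing.Theory Num.Theory.
Import numFieldNormedType.Exports.

Local Open Scope classical_set_scope.
Local Open Scope ring_scope.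
Local Open Scope ereal_scope.

(* Functions on (0, oo) are represented by total functions [R -> R]; only their
   restriction to [`]0, +oo[] is ever used. *)
Definition nonneg_measurable {R : realType} (f : R -> R) : Prop :=
  measurable_fun (`]0%R, +oo[%classic : set R) f /\
  (forall t, 0 < t -> 0 <= f t)%R.

(* [x ^ r] for real [x >= 0], with [0 ^ r = +oo] when [r < 0]
   (whereas [powR 0 r = 0] for every [r != 0]). *)
Definition epowR {R : realType} (x r : R) : \bar R :=
  if (x == 0%R) && (r < 0)%R then +oo else (x `^ r)%R%:E.

Section LebesgueStieltjes.
Context {R : realType}.
Variable g : R -> \bar R.

(* For [g] nondecreasing with values in [0, +oo], the infimum over [s > t] is
   the right limit at [t], so that [ls_trunc n] is the right-continuous
   version of [min(g, n)], which determines the same Stieltjes measure. *)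
Definition ls_trunc (n : nat) (t : R) : R :=
  fine (ereal_inf [set maxe 0 (mine (g s) n%:R%:E) | s in `]t, +oo[%classic]).

Let tr (n : nat) (s : R) : \bar R := maxe 0 (mine (g s) n%:R%:E).

Let tr_ge0 n s : 0 <= tr n s. Proof. by rewrite /tr le_max lexx. Qed.

Let tr_le n s : tr n s <= n%:R%:E.
Proof. by rewrite /tr ge_max lee_fin ler0n ge_min lexx orbT. Qed.

Let ls_truncE n t :
  (ls_trunc n t)%:E = ereal_inf [set tr n s | s in `]t, +oo[%classic].
Proof.
rewrite fineK// ge0_fin_numE; last first.
  by apply: le_ereal_inf_tmp => _ [s _ <-]; exact: tr_ge0.
apply: (@le_lt_trans _ _ (tr n (t + 1)%R)); last first.
  by apply: (le_lt_trans (tr_le _ _)); rewrite ltry.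
apply: ereal_inf_lbound; exists (t + 1)%R => //=.
by rewrite in_itv/= andbT ltrDl.
Qed.

Let ls_trunc_nd n : nondecreasing (ls_trunc n).
Proof.
move=> x y xy; rewrite -lee_fin !ls_truncE; apply: ereal_inf_le_tmp.
move=> _ [s /= ys <-]; exists s => //=; move: ys.
by rewrite !in_itv/= !andbT; exact: le_lt_trans.
Qed.

Let ls_trunc_rc n : right_continuous (ls_trunc n).
Proof.
move=> x; apply/cvgrPdist_lt => e e0.
have : ereal_inf [set tr n s | s in `]x, +oo[%classic]
       < (ls_trunc n x + e)%R%:E.
  by rewrite -ls_truncE lte_fin ltrDl.
move=> /ereal_inf_lt[_ [s /= xs <-]] se.
move: xs; rewrite in_itv/= andbT => xs.
near=> y.
have xy : (x < y)%R by near: y; exact: nbhs_right_gt.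
have ys : (y < s)%R by near: y; exact: nbhs_right_lt.
rewrite distrC ger0_norm ?subr_ge0 ?ls_trunc_nd ?ltW//.
rewrite ltrBlDl -lte_fin; apply: le_lt_trans se; rewrite ls_truncE.
by apply: ereal_inf_lbound; exists s => //=; rewrite in_itv/= ys.
Unshelve. all: by end_near. Qed.

HB.instance Definition _ (n : nat) :=
  isCumulative.Build R _ R (ls_trunc n) (@ls_trunc_nd n) (@ls_trunc_rc n).

(* The Stieltjes integral over [D] of [F >= 0] with respect to [dg], for [g]
   nondecreasing with values in [0, +oo]. Since [g] may take the value [+oo],
   it is obtained as the limit, as [n] grows, of the increasing sequence of
   Stieltjes integrals with respect to [min(g, n)]. *)
Definition ls_integral (D : set R) (F : R -> \bar R) : \bar R :=
  ereal_sup [set \int[lebesgue_stieltjes_measure (ls_trunc n)]_(t in D) F t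
            | n in [set: nat]].

End LebesgueStieltjes.

Section HardyWeights.
Context {R : realType}.
Implicit Types (v w : R -> R) (p q t : R).

(* The essential supremum over (0, t) is that of the (nonnegative) extension
   of [1 / v] by 0 outside (0, t); [(v s)%:E^-1] is [+oo] where [v s = 0].
   Both formulas give [hardyV v p t = 0] for [t <= 0]. *)
Definition hardyV v p t : \bar R :=
  let p' := fine (hoelder_conjugate p%:E) in
  if (1 < p)%R then
    (\int[lebesgue_measure]_(s in `]0%R, t[) epowR (v s) (1 - p')) `^ (p'^-1)
  else
    ess_sup lebesgue_measure ((fun s => (v s)%:E^-1) \_ `]0%R, t[).

Definition hardyW w t : \bar R :=
  \int[lebesgue_measure]_(s in `]t, +oo[) (w s)%:E.

(* In the case [q < p] the integral is over [0, +oo) with [V(0) = 0]: the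
   Stieltjes measure has at 0 an atom of mass [V(0+) ^ (p q / (p - q))]. It can
   be nonzero: when [p = 1] and [v = 1], it is the whole measure. *)
Definition hardyA v w p q : \bar R :=
  if (p <= q)%R then
    ereal_sup [set hardyV v p t * hardyW w t `^ (q^-1) | t in `]0%R, +oo[]
  else
    ls_integral (fun t => hardyV v p t `^ (p * q / (p - q)))
      `[0%R, +oo[ (fun t => hardyW w t `^ (p / (p - q))).

End HardyWeights.

(* Main.v *)
(* The primitive h of f is cut at the points T_k where h(T_k) = 2^-k h(oo): between
   T_(k+1) and T_k, h is at most 4 times the integral of f over [T_(k+2), T_(k+1)[,
   to which Hoelder's inequality applies, with constant at most V(T_(k+1)). If the
   integral of f^p v is at most 1 and p <= q, the block k contributes at most a
   constant times A^q times its share of that integral; when q < p, Young's inequality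
   reduces the claim to sum_k V(T_k)^r w(E_k)^(p/(p-q)) <= A with r = pq/(p-q) and
   E_k the part of (T_k, oo) where h is of order 2^-k. This holds because V(T_k)^r is
   the Stieltjes mass of [0, T_k] and, for each s, the masses w(E_k) with T_k >= s
   sum up to at most W(s).

   Conversely Hoelder's inequality is nearly sharp, which yields test functions
   realizing V(t) and settles p <= q. When q < p, the integral defining A is cut at
   the points where V^r crosses the levels of a geometric sequence, and the test
   function is a maximum of multiples of the functions realizing V at those points;
   this bounds the sum over the blocks of w, and the tails W are recovered from the
   blocks because the levels are geometric. *)

Require Import Defs.
From mathcomp Require Import all_boot all_order all_algebra.
From mathcomp Require Import all_classical all_reals all_analysis.
From mathcomp Require Import ess_sup_inf measurable_realfun.
From mathcomp Require Import ring.
Set Implicit Arguments.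
Unset Strict Implicit.
Unset Printing Implicit Defensive.
Import Order.TTheory GRing.Theory Num.Theory.
Import numFieldNormedType.Exports.
Local Open Scope classical_set_scope.
Local Open Scope ring_scope.
Local Open Scope ereal_scope.

(** * Powers of extended real numbers *)

(** Infinite values are the main obstacle, since [V], [W] and the powers of [V] may all be [+oo].
    Finiteness of [A] makes [V(t)] finite only where [W(t) > 0], so blocks without [w]-mass are
    discarded before Hoelder's inequality is used; conversely, the inequality makes [W(t)] finite
    only for [t > 0]. The points [T_k] come from the intermediate value theorem, which asks for a
    finite continuous primitive. The argument therefore runs first for bounded [f] supported in a
    bounded interval, and monotone convergence and scaling give the rest. In the converse with
    [q < p], the Stieltjes function is truncated, hence has a finite supremum, and the levels
    descend geometrically from it. A level point sees its level only as a right limit, and [W(0)]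
    may be infinite; both defects disappear if [W(t + e)] is integrated in place of [W(t)], with a
    bound independent of [e]. *)

Section ereal_powers.
Context {R : realType}.
Implicit Types (x y : \bar R) (r : R).

Lemma lee_poweR x y r : (0 <= r)%R -> 0 <= x -> x <= y -> x `^ r <= y `^ r.
Proof.
move=> r0 x0 xy; apply: gt0_ler_poweR => //; rewrite in_itv/= leey andbT//.
exact: le_trans xy.
Qed.

Lemma poweRK x r : (0 < r)%R -> 0 <= x -> (x `^ r) `^ r^-1 = x.
Proof. by move=> r0 x0; rewrite -poweRrM divff ?gt_eqF// poweRe1. Qed.

Lemma poweRVK x r : (0 < r)%R -> 0 <= x -> (x `^ r^-1) `^ r = x.
Proof. by move=> r0 x0; rewrite -poweRrM mulVf ?gt_eqF// poweRe1. Qed.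

Lemma lee_poweR_le1 x r : (1 <= r)%R -> 0 <= x -> x <= 1 -> x `^ r <= x.
Proof.
case: x => [x| |]// r1; rewrite !lee_fin => x0 x1.
rewrite le_eqVlt in x0; case/predU1P : x0 => [<-|x0].
  by rewrite powR0// gt_eqF// (lt_le_trans _ r1).
by rewrite ge1r_powR// x0.
Qed.

(** Write [a ^ r] as [a * a ^ (r - 1)] and enlarge the second factor to [(a + b) ^ (r - 1)], which
    is where [r >= 1] enters. *)
Lemma powR_superadd (a b : R) r : (1 <= r)%R -> (0 <= a)%R -> (0 <= b)%R ->
  (a `^ r + b `^ r <= (a + b) `^ r)%R.
Proof.
move=> r1 a0 b0; have r0 : (0 < r)%R by exact: lt_le_trans r1.
rewrite -(mulr_powRB1 a0 r0) -(mulr_powRB1 b0 r0).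
rewrite -(mulr_powRB1 (addr_ge0 a0 b0) r0) mulrDl.
by apply: lerD; rewrite ler_wpM2l// ge0_ler_powR ?subr_ge0 ?nnegrE ?addr_ge0//;
  rewrite ?lerDl ?lerDr.
Qed.

Lemma poweR_superadd x y r : (1 <= r)%R -> 0 <= x -> 0 <= y ->
  x `^ r + y `^ r <= (x + y) `^ r.
Proof.
move=> r1; have r0 : (r != 0)%R by rewrite gt_eqF// (lt_le_trans _ r1).
case: x => [x| |]//; case: y => [y| |]//; rewrite ?lee_fin => x0 y0.
- exact: powR_superadd.
- by rewrite addey// poweRyr// leey.
- by rewrite addye// poweRyr// leey.
- by rewrite addye// poweRyr// leey.
Qed.

Lemma sum_poweR_le (I : Type) (s : seq I) (P : pred I) (F : I -> \bar R) r :
  (1 <= r)%R -> (forall i, 0 <= F i) ->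
  \sum_(i <- s | P i) F i `^ r <= (\sum_(i <- s | P i) F i) `^ r.
Proof.
move=> r1 F0; have r0 : (r != 0)%R by rewrite gt_eqF// (lt_le_trans _ r1).
elim: s => [|i s ih]; first by rewrite !big_nil poweR0r.
rewrite !big_cons; case: ifP => // _.
apply: (@le_trans _ _ (F i `^ r + (\sum_(j <- s | P j) F j) `^ r)).
  exact: leeD.
by apply: poweR_superadd => //; exact: sume_ge0.
Qed.

Lemma poweR_subadd2 x y r : (0 <= r)%R -> 0 <= x -> 0 <= y ->
  (x + y) `^ r <= 2%:E `^ r * (x `^ r + y `^ r).
Proof.
move=> r0 x0 y0.
wlog xy : x y x0 y0 / x <= y.
  by move=> h; have [/h|/ltW/h] := leP x y; [exact|rewrite addeC (addeC (y `^ r)); exact].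
apply: (@le_trans _ _ ((2%:E * y) `^ r)).
  by apply: lee_poweR; rewrite ?adde_ge0// mule_natl mule2n leeD2r.
by rewrite poweRM// lee_wpmul2l ?poweR_ge0// leeDr// poweR_ge0.
Qed.

(* Young's inequality without its constants: each factor is at most a power of
   the larger of [x ^ b] and [y ^ b']. *)
Lemma crude_young x y (b b' : R) : 0 <= x -> 0 <= y ->
  (0 < b)%R -> (0 < b')%R -> (b^-1 + b'^-1 = 1)%R -> x * y <= x `^ b + y `^ b'.
Proof.
move=> x0 y0 b0 b'0 bb'; pose u := maxe (x `^ b) (y `^ b').
have u0 : 0 <= u by rewrite le_max poweR_ge0.
apply: (@le_trans _ _ u); last first.
  by rewrite ge_max leeDl ?poweR_ge0// leeDr ?poweR_ge0.
have -> : u = u `^ b^-1 * u `^ b'^-1.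
  rewrite -poweRD ?bb' ?poweRe1// add_neq0_poweRD_def// bb' oner_eq0//.
apply: lee_pmul => //.
- rewrite -{1}(poweRK b0 x0); apply: lee_poweR; rewrite ?poweR_ge0//.
    by rewrite invr_ge0 ltW.
  by rewrite le_max lexx.
- rewrite -{1}(poweRK b'0 y0); apply: lee_poweR; rewrite ?poweR_ge0//.
    by rewrite invr_ge0 ltW.
  by rewrite le_max lexx orbT.
Qed.

End ereal_powers.

Section monotone_measurable.
Context {R : realType}.

Lemma nondecreasing_emeasurable (D : set R) (g : R -> \bar R) : measurable D ->
  {homo g : x y / (x <= y)%R >-> x <= y} -> measurable_fun D g.
Proof.
move=> mD gnd.
apply: (measurability _ (ErealGenCInfty.measurableE R)) => // _ [_ [r ->] <-].
apply: measurableI => //; apply: is_interval_measurable => s t/=.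
rewrite !in_itv/= !andbT => rs rt x /andP[sx _].
by rewrite in_itv/= andbT (le_trans rs)// gnd.
Qed.

Lemma nonincreasing_emeasurable (D : set R) (g : R -> \bar R) : measurable D ->
  {homo g : x y / (x <= y)%R >-> y <= x} -> measurable_fun D g.
Proof.
move=> mD gni.
apply: (measurability _ (ErealGenCInfty.measurableE R)) => // _ [_ [r ->] <-].
apply: measurableI => //; apply: is_interval_measurable => s t/=.
rewrite !in_itv/= !andbT => rs rt x /andP[_ xt].
by rewrite in_itv/= andbT (le_trans rt)// gni.
Qed.

End monotone_measurable.

(** * Hoelder's inequality and its sharpness *)

Section hardy_weight.
Context {R : realType}.
Implicit Types (v w f : R -> R) (p q t : R).
Local Notation mu := (@lebesgue_measure R).

Lemma lebesgue_measureT_gt0 : 0 < mu [set: R].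
Proof. by rewrite -set_itvNyy lebesgue_measure_itv/= ltry. Qed.

Lemma subset_itvoo (t : R) : `]0%R, t[ `<=` (`]0%R, +oo[ : set R).
Proof. by move=> x/=; rewrite !in_itv/= => /andP[->]. Qed.

Lemma measurable_epowR r : measurable_fun [set: R] (fun x : R => epowR x r).
Proof.
apply: measurable_fun_ifT => //=.
- apply: measurable_and => //=.
  by apply: measurable_fun_eqr => //; exact: measurable_cst.
- by apply/measurable_EFinP; exact: measurable_powR.
Qed.

Lemma epowR_ge0 (x r : R) : 0 <= epowR x r.
Proof. by rewrite /epowR; case: ifP => // _; rewrite lee_fin powR_ge0. Qed.

Lemma hardyVE v p t : (1 < p)%R -> hardyV v p t =
  (\int[mu]_(s in `]0%R, t[) epowR (v s) (- (p - 1)^-1)) `^ ((p - 1) / p).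
Proof.
move=> p1; have p0 : (p != 0)%R by rewrite gt_eqF// (lt_trans _ p1).
have p10 : (p - 1 != 0)%R by rewrite subr_eq0 gt_eqF.
rewrite /hardyV p1 /hoelder_conjugate/= eqe (negbTE p0) -EFinD.
rewrite inver (negbTE p10)/= invf_div.
by have -> : (1 - p / (p - 1) = - (p - 1)^-1)%R by field.
Qed.

Lemma hardyV1E v t :
  hardyV v 1%R t = ess_sup mu ((fun s => (v s)%:E^-1) \_ `]0%R, t[).
Proof. by rewrite /hardyV ltxx. Qed.

Lemma measurable_epowR_comp v r (D : set R) : nonneg_measurable v ->
  measurable D -> D `<=` `]0%R, +oo[ ->
  measurable_fun D (fun s => epowR (v s) r).
Proof.
move=> [mv _] mD DE; apply: (measurableT_comp (measurable_epowR r)).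
by apply: measurable_funS mv.
Qed.

Lemma hardyV_ge0 v p t : nonneg_measurable v -> (1 <= p)%R -> 0 <= hardyV v p t.
Proof.
move=> hv; rewrite le_eqVlt => /predU1P[<-|p1]; last first.
  by rewrite hardyVE// poweR_ge0.
rewrite hardyV1E; apply: ess_sup_gee.
  exact: lebesgue_measureT_gt0.
apply: nearW => s; rewrite patchE; case: ifPn => //; rewrite inE/= in_itv/=.
by move=> /andP[s0 _]; rewrite inve_ge0 lee_fin hv.2.
Qed.

Lemma hardyV_le0 v p t : nonneg_measurable v -> (1 <= p)%R -> (t <= 0)%R ->
  hardyV v p t = 0.
Proof.
move=> hv + t0; have e0 : `]0%R, t[%classic = set0 :> set R.
  apply/seteqP; split => // x/=; rewrite in_itv/= => /andP[x0 xt].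
  by have := lt_le_trans (lt_trans x0 xt) t0; rewrite ltxx.
rewrite le_eqVlt => /predU1P[<-|p1]; last first.
  rewrite hardyVE// e0 integral_set0 poweR0r// mulf_neq0//.
    by rewrite subr_eq0 gt_eqF.
  by rewrite invr_neq0// gt_eqF// (lt_trans _ p1).
by rewrite hardyV1E e0 patch_set0 ess_sup_cst//; exact: lebesgue_measureT_gt0.
Qed.

Lemma hardyV_nd v p s t : nonneg_measurable v -> (1 <= p)%R -> (s <= t)%R ->
  hardyV v p s <= hardyV v p t.
Proof.
move=> hv + st; have sub : `]0%R, s[ `<=` (`]0%R, t[ : set R).
  move=> x/=; rewrite !in_itv/= => /andP[-> xs].
  by rewrite (lt_le_trans xs).
rewrite le_eqVlt => /predU1P[<-|p1]; last first.
  rewrite !hardyVE//; apply: lee_poweR.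
  - by rewrite divr_ge0 ?subr_ge0 ?ltW// (lt_trans _ p1).
  - by apply: integral_ge0 => x _; exact: epowR_ge0.
  - apply: ge0_subset_integral => //; last by move=> x _; exact: epowR_ge0.
    by apply: measurable_epowR_comp => //; exact: subset_itvoo.
rewrite !hardyV1E; apply: le_ess_sup; apply: nearW => x.
rewrite !patchE; case: ifPn => [|_]; rewrite ?inE.
  by move=> /sub xt; rewrite mem_set.
case: ifPn => //; rewrite inE/= in_itv/=.
by move=> /andP[x0 _]; rewrite inve_ge0 lee_fin hv.2.
Qed.

Lemma measurable_powRw f v p (D : set R) : nonneg_measurable f ->
  nonneg_measurable v -> measurable D -> D `<=` `]0%R, +oo[ ->
  measurable_fun D (fun s => (f s `^ p * v s)%:E).
Proof.
move=> [mf _] [mv _] mD DE; apply/measurable_EFinP.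
apply: measurable_funM; last by apply: measurable_funS mv.
by apply: (measurableT_comp (measurable_powR _)); apply: measurable_funS mf.
Qed.

(** For [p > 1] the factorization is [f = (f v^(1/p)) v^(-1/p)]; for [p = 1], [1 / v <= V] almost
    everywhere gives [f <= V f v]. Finiteness of [V] makes [v] positive almost everywhere on [D].
    With [V = +oo] the claim can fail, since [+oo * 0 = 0]. *)
Lemma hardyV_hoelder v f p b (D : set R) :
  nonneg_measurable v -> nonneg_measurable f -> (1 <= p)%R ->
  measurable D -> D `<=` `]0%R, b[ -> hardyV v p b < +oo ->
  \int[mu]_(s in D) (f s)%:E
  <= hardyV v p b * (\int[mu]_(s in D) (f s `^ p * v s)%:E) `^ p^-1.
Proof.
move=> hv hf + mD Db; have D0 : D `<=` `]0%R, +oo[.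
  exact: subset_trans Db (@subset_itvoo b).
have pos s : D s -> (0 < s)%R by move/D0; rewrite /= in_itv/= andbT.
have mf : measurable_fun D f by apply: measurable_funS hf.1.
have mv : measurable_fun D v by apply: measurable_funS hv.1.
have f0 s : D s -> (0 <= f s)%R by move/pos/hf.2.
have v0 s : D s -> (0 <= v s)%R by move/pos/hv.2.
rewrite le_eqVlt => /predU1P[<-|p1] Vb.
  rewrite invr1 poweRe1; last first.
    by apply: integral_ge0 => s Ds; rewrite lee_fin mulr_ge0 ?powR_ge0// v0.
  have Vfin : hardyV v 1 b \is a fin_num by rewrite ge0_fin_numE// hardyV_ge0.
  rewrite -ge0_integralZl//=; first last.
  - exact: hardyV_ge0.
  - by move=> s Ds; rewrite lee_fin mulr_ge0 ?powR_ge0// v0.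
  - exact: measurable_powRw.
  apply: ae_ge0_le_integral => //.
  - exact/measurable_EFinP.
  - move=> s Ds; rewrite mule_ge0 ?hardyV_ge0//.
    by rewrite lee_fin mulr_ge0 ?powR_ge0// v0.
  - by apply: emeasurable_funM => //; exact: measurable_powRw.
  have := ess_sup_ge mu ((fun s => (v s)%:E^-1) \_ `]0%R, b[).
  rewrite -hardyV1E; apply: filterS => s + Ds.
  rewrite patchE mem_set; last exact: Db.
  rewrite -{2}(fineK Vfin) -{1}(fineK Vfin) inver; case: ifPn => // vs0.
  rewrite powRr1 ?f0// lee_fin -EFinM lee_fin => vV.
  rewrite mulrCA ler_peMr ?f0//.
  by rewrite -ler_pdivrMr ?div1r// lt_def vs0 v0.
have p0 : (0 < p)%R by rewrite (lt_trans _ p1).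
have p10 : (0 < p - 1)%R by rewrite subr_gt0.
pose F := (fun s => f s * v s `^ p^-1)%R \_ D.
pose G := (fun s => v s `^ (- p^-1))%R \_ D.
have mF : measurable_fun [set: R] F.
  apply/(measurable_restrictT _ mD); apply: measurable_funM => //.
  exact: (measurableT_comp (measurable_powR _)).
have mG : measurable_fun [set: R] G.
  apply/(measurable_restrictT _ mD).
  exact: (measurableT_comp (measurable_powR _)).
have Vfin : \int[mu]_(s in `]0%R, b[) epowR (v s) (- (p - 1)^-1) < +oo.
  move: Vb; rewrite hardyVE//; apply: lty_poweRy.
  by rewrite mulf_neq0// ?invr_neq0 ?gt_eqF.
have mw E : measurable E -> E `<=` `]0%R, b[ ->
    measurable_fun E (fun s => epowR (v s) (- (p - 1)^-1)).
  move=> mE Eb; apply: measurable_epowR_comp => //.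
  exact: subset_trans Eb (@subset_itvoo b).
have pp' : (p^-1 + (p / (p - 1))^-1 = 1)%R.
  by rewrite invf_div; field; rewrite gt_eqF.
have p'0 : (0 < p / (p - 1))%R by rewrite divr_gt0.
have := @hoelder _ _ _ mu F G p (p / (p - 1)) mF mG p0 p'0 pp'.
rewrite Lnorm1.
have -> : \int[mu]_x `|(EFin \o (F \* G)%R) x| = \int[mu]_(s in D) (f s)%:E.
  rewrite [RHS]integral_mkcond; apply: ge0_ae_eq_integral => //.
  - by do 2 apply: measurableT_comp => //; exact: measurable_funM.
  - by apply/(measurable_restrictT _ mD)/measurable_EFinP.
  - by move=> s _; rewrite patchE; case: ifPn => //; rewrite inE => /f0.
  (* Where [v = 0], [powR] gives [v^(-1/p) = 0] and the factorization breaks. At such points [epowR]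
     is [+oo], so integrability makes them negligible. *)
  have iw : mu.-integrable D (fun s => epowR (v s) (- (p - 1)^-1)).
    apply/integrableP; split; first exact: mw.
    under eq_integral do rewrite gee0_abs ?epowR_ge0//.
    apply: le_lt_trans Vfin; apply: ge0_subset_integral => //.
      exact: mw.
    by move=> s _; exact: epowR_ge0.
  have := @integrable_ae _ _ R mu D mD _ iw; apply: filterS => s + _.
  rewrite /= /F /G !patchE; case: ifPn => [|_ _]; last by rewrite mulr0 normr0.
  rewrite inE => Ds /(_ Ds); rewrite /epowR oppr_lt0 invr_gt0 p10 andbT.
  case: ifPn => // vs0 _; rewrite -mulrA -powRD ?subrr ?powRr0 ?mulr1 ?vs0 ?implybT//.
  by rewrite ger0_norm// f0.
move=> /le_trans; apply; rewrite muleC; apply: lee_pmul; rewrite ?Lnorm_ge0//.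
  rewrite unlock hardyVE// invf_div; apply: lee_poweR.
  - by rewrite divr_ge0 ?ltW.
  - by apply: integral_ge0 => s _; exact: poweR_ge0.
  apply: (@le_trans _ _ (\int[mu]_(s in D) epowR (v s) (- (p - 1)^-1))).
    rewrite [leRHS]integral_mkcond; apply: ge0_le_integral => //.
    - by move=> s _; exact: poweR_ge0.
    - apply: (measurableT_comp (measurable_poweR _)).
      by do 2 apply: measurableT_comp => //.
    - by apply/(measurable_restrictT _ mD); exact: mw.
    move=> s _; rewrite /= /G !patchE; case: ifPn; last first.
      by rewrite normr0 powR0// gt_eqF.
    rewrite inE => Ds; rewrite ger0_norm ?powR_ge0// -powRrM.
    rewrite /epowR oppr_lt0 invr_gt0 p10 andbT; case: ifPn => _; first exact: leey.
    rewrite lee_fin; have -> // : (- p^-1 * (p / (p - 1)) = - (p - 1)^-1)%R.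
    by field; rewrite !gt_eqF.
  apply: ge0_subset_integral => //; first exact: mw.
  by move=> s _; exact: epowR_ge0.
rewrite unlock [in leRHS]integral_mkcond.
apply: lee_poweR; first by rewrite invr_ge0 ltW.
  by apply: integral_ge0 => s _; exact: poweR_ge0.
rewrite le_eqVlt; apply/orP; left; apply/eqP; apply: eq_integral => s _.
rewrite /= /F !patchE; case: ifPn; last first.
  by rewrite normr0 powR0// gt_eqF.
rewrite inE => Ds; rewrite ger0_norm ?mulr_ge0 ?powR_ge0 ?f0//.
by rewrite powRM ?f0 ?powR_ge0// -powRrM mulVf ?gt_eqF// powRr1// v0.
Qed.

Lemma cvg_mine_nat (a : \bar R) : mine a n%:R%:E @[n --> \oo] --> a.
Proof.
case: a => [a| |].
- apply: cvg_near_cst; near=> n; apply/min_idPl; rewrite lee_fin.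
  by near: n; exact: nbhs_infty_ger.
- under eq_cvg do rewrite min_r ?leey//.
  by apply/cvgeryP; exact: cvgr_idn.
- by apply: cvg_near_cst; near=> n; apply/min_idPl; exact: leNye.
Unshelve. all: by end_near. Qed.

(* For [p = 1] the test function concentrates where [1 / v > c]; for [p > 1] it
   is a truncation of [v ^ (1 - p')], the extremal of Hoelder's inequality. *)
Lemma hardyV_test v p t (c : R) : nonneg_measurable v -> (1 <= p)%R ->
  (0 < c)%R -> c%:E < hardyV v p t ->
  exists f : R -> R, [/\ nonneg_measurable f,
    \int[mu]_(s in `]0%R, +oo[) (f s `^ p * v s)%:E <= 1 &
    c%:E <= \int[mu]_(s in `]0%R, t[) (f s)%:E].
Proof.
move=> hv p1 c0 cV.
have t0 : (0 < t)%R.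
  rewrite ltNge; apply/negP => t0; move: cV; rewrite hardyV_le0// lte_fin ltNge.
  by rewrite ltW.
have mut : mu `]0%R, t[ = t%:E.
  by rewrite lebesgue_measure_itv/= lte_fin t0 -EFinB subr0.
move: p1; rewrite le_eqVlt => /predU1P[p1|p1].
  subst p.
  pose E := `]0%R, t[ `&` [set s | (c * v s <= 1)%R].
  have mv : measurable_fun `]0%R, t[ v.
    by apply: measurable_funS hv.1 => //; exact: subset_itvoo.
  have mE : measurable E.
    by apply: measurable_fun_le => //; exact: measurable_funM.
  have Et : E `<=` `]0%R, t[ by move=> x [].
  have E0 s : E s -> (0 < s)%R by move/Et; rewrite /= in_itv/= => /andP[].
  have muE0 : mu E != 0.
    apply/negP => /eqP muE; move: cV; rewrite ltNge => /negP; apply.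
    rewrite hardyV1E; apply/ess_supP; exists E; split => // s /=.
    rewrite patchE; case: ifPn; last by rewrite lee_fin ltW.
    rewrite inE => st nle; split => //=; rewrite leNgt; apply/negP => cvs.
    apply: nle; have cv0 : (0 < c * v s)%R by exact: lt_trans cvs.
    rewrite pmulr_rgt0// in cv0.
    by rewrite inver gt_eqF// lee_fin -[leLHS]mul1r ler_pdivrMr// ltW.
  have muEfin : mu E \is a fin_num.
    rewrite ge0_fin_numE//; apply: (@le_lt_trans _ _ (mu `]0%R, t[)).
      by apply: le_measure; rewrite ?inE.
    by rewrite mut ltry.
  pose m := fine (mu E).
  have m0 : (0 < m)%R by rewrite fine_gt0// lt_neqAle eq_sym muE0 measure_ge0 -ge0_fin_numE.
  have muEm : mu E = m%:E by rewrite fineK.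
  have cm0 : (0 < c / m)%R by rewrite divr_gt0.
  (* The height [c / m] gives the integral [c] over [E], and [c v <= 1] on [E] bounds the weighted
     integral by [mu E / m = 1]. *)
  exists (cst (c / m)%R \_ E); split.
  - split; last by move=> s _; rewrite patchE; case: ifPn => // _; exact: ltW.
    apply: (measurable_funS measurableT) => //.
    by apply/(measurable_restrictT _ mE).
  - rewrite (_ : \int[mu]_(s in _) _ = \int[mu]_(s in E) (c / m * v s)%:E).
      apply: (@le_trans _ _ (\int[mu]_(s in E) (cst (m^-1)%:E) s)).
        apply: ge0_le_integral => //.
        + by move=> s Es; rewrite lee_fin mulr_ge0 ?(ltW cm0)// hv.2// E0.
        + apply/measurable_EFinP; apply: measurable_funM => //.
          exact: measurable_funS mv.
        move=> s [_ /= cv]; rewrite lee_fin mulrAC -[leRHS]mul1r.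
        by rewrite ler_wpM2r// invr_ge0 ltW.
      by rewrite integral_cst// [X in _ * X]muEm -EFinM mulVf// gt_eqF.
    rewrite -[in RHS](setIidr (subset_trans Et (@subset_itvoo t))).
    rewrite integral_mkcondr; apply: eq_integral => s _.
    by rewrite !patchE; case: ifPn; rewrite powRr1 ?mul0r// ltW.
  - rewrite (_ : \int[mu]_(s in _) _ = \int[mu]_(s in E) (cst (c / m)%:E) s).
      by rewrite integral_cst// [X in _ * X]muEm -EFinM divfK// gt_eqF.
    rewrite -[in RHS](setIidr Et) integral_mkcondr; apply: eq_integral => s _.
    by rewrite !patchE; case: ifPn.
have p0 : (0 < p)%R by rewrite (lt_trans _ p1).
have p10 : (0 < p - 1)%R by rewrite subr_gt0.
have cE : c = ((c `^ (p / (p - 1))) `^ ((p - 1) / p))%R.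
  rewrite -powRrM (_ : p / (p - 1) * ((p - 1) / p) = 1)%R ?powRr1 ?ltW//.
  by field; rewrite !gt_eqF.
pose e := (- (p - 1)^-1)%R.
(* Truncation at height [m] keeps the integral [J m] finite even if [V(t)] is not. The threshold
   [c^(p/(p-1))] for [J m] is what [c < V(t)] becomes after raising to the power [p']. *)
pose phi (m : nat) s := mine (epowR (v s) e) m%:R%:E.
have phi0 m s : 0 <= phi m s by rewrite le_min epowR_ge0 lee_fin ler0n.
have mphi m D : measurable D -> D `<=` `]0%R, t[ -> measurable_fun D (phi m).
  move=> mD Dt; apply: measurable_mine => //; apply: measurable_epowR_comp => //.
  exact: subset_trans Dt (@subset_itvoo t).
pose J m := \int[mu]_(s in `]0%R, t[) phi m s.
have [m cJ] : exists m, (c `^ (p / (p - 1)))%:E < J m.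
  apply: contrapT => /forallNP Jc; move: cV; rewrite ltNge => /negP; apply.
  have Jle : \int[mu]_(s in `]0%R, t[) epowR (v s) e <= (c `^ (p / (p - 1)))%:E.
    have -> : \int[mu]_(s in `]0%R, t[) epowR (v s) e =
        \int[mu]_(s in `]0%R, t[) (limn (phi^~ s)).
      by apply: eq_integral => s _; apply/esym/cvg_lim => //; exact: cvg_mine_nat.
    rewrite monotone_convergence//; last 2 first.
      - by move=> n; exact: mphi.
      - move=> s _ m n mn; rewrite /phi le_min ge_min lexx/= ge_min lee_fin.
        by rewrite ler_nat mn orbT.
    apply: lime_le.
      apply: ereal_nondecreasing_is_cvgn => m n mn; apply: ge0_le_integral => //.
      + exact: mphi.
      + exact: mphi.
      + move=> s _; rewrite /phi le_min ge_min lexx/= ge_min lee_fin.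
        by rewrite ler_nat mn orbT.
    by apply: nearW => n; rewrite leNgt; apply/negP/Jc.
  rewrite hardyVE//.
  rewrite cE -poweR_EFin; apply: lee_poweR => //.
    by rewrite divr_ge0 ?ltW.
  by apply: integral_ge0 => s _; exact: epowR_ge0.
have Jfin : J m \is a fin_num.
  rewrite ge0_fin_numE; last exact: integral_ge0.
  apply: (@le_lt_trans _ _ (\int[mu]_(s in `]0%R, t[) (cst m%:R%:E) s)).
    apply: ge0_le_integral => //; first exact: mphi.
    by move=> s _; rewrite ge_min lexx orbT.
  by rewrite integral_cst// [X in _ * X]mut -EFinM ltry.
pose j := fine (J m); have Jj : J m = j%:E by rewrite fineK.
have cj : (c `^ (p / (p - 1)) < j)%R by rewrite -lte_fin -Jj.
have j0 : (0 < j)%R by rewrite (le_lt_trans _ cj)// powR_ge0.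
have phifin s : phi m s = (fine (phi m s))%:E.
  by rewrite fineK// ge0_fin_numE// gt_min ltry orbT.
have fphi0 s : (0 <= fine (phi m s))%R by rewrite fine_ge0.
have mfphi : measurable_fun `]0%R, t[ (fine \o phi m).
  by apply: measurableT_comp => //; exact: mphi.
(* The factor [j^(-1/p)] normalizes: [phi^(p-1) v <= 1] where [v > 0], so [phi^p v <= phi] and the
   weighted integral is at most [J m / j = 1], while the plain integral is [j^(1 - 1/p) >= c]. *)
pose f := (fun s => fine (phi m s) * j `^ (- p^-1))%R \_ `]0%R, t[.
have f0 s : (0 <= f s)%R.
  by rewrite /f patchE; case: ifPn => // _; rewrite mulr_ge0 ?powR_ge0.
exists f; split.
- split => //; apply: (measurable_funS measurableT) => //.
  have mt : measurable (`]0%R, t[ : set R) by [].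
  by apply/(measurable_restrictT _ mt); exact: measurable_funM.
- rewrite (_ : \int[mu]_(s in _) _ =
      \int[mu]_(s in `]0%R, t[) ((j^-1)%:E * ((fine (phi m s)) `^ p * v s)%:E)).
    apply: (@le_trans _ _ (\int[mu]_(s in `]0%R, t[) ((j^-1)%:E * phi m s))).
      apply: ge0_le_integral => //.
      + move=> s; rewrite /= in_itv/= => /andP[s0 _].
        by rewrite -EFinM lee_fin mulr_ge0 ?invr_ge0 ?(ltW j0)// mulr_ge0 ?powR_ge0// hv.2.
      + apply: emeasurable_funM => //; apply/measurable_EFinP.
        apply: measurable_funM; last first.
          by apply: measurable_funS hv.1 => //; exact: subset_itvoo.
        exact: (measurableT_comp (measurable_powR _)).
      + by apply: emeasurable_funM => //; exact: mphi.
      + move=> s; rewrite /= in_itv/= => /andP[s0 _].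
        rewrite [phi m s in leRHS]phifin -!EFinM lee_fin ler_pM2l ?invr_gt0//.
        rewrite -(mulr_powRB1 _ p0)// -mulrA ler_piMr//.
        have [->|vs0] := eqVneq (v s) 0%R; first by rewrite mulr0.
        have vs : (0 < v s)%R by rewrite lt_def vs0 hv.2.
        rewrite -ler_pdivlMr// div1r -powR_inv1 ?(ltW vs)//.
        have -> : (v s `^ (-1) = (v s `^ e) `^ (p - 1))%R.
          by rewrite -powRrM /e mulNr mulVf// gt_eqF.
        apply: ge0_ler_powR; rewrite ?nnegrE ?powR_ge0 ?(ltW p10)//.
        by rewrite -lee_fin -phifin ge_min /epowR (negbTE vs0)/= lexx.
    rewrite ge0_integralZl//; first by rewrite -/(J m) Jj -EFinM mulVf// gt_eqF.
      exact: mphi.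
    by rewrite lee_fin invr_ge0 ltW.
  rewrite -[in RHS](setIidr (@subset_itvoo t)) [in RHS]integral_mkcondr.
  apply: eq_integral => s _; rewrite /f !patchE; case: ifPn => // _; last first.
    by rewrite powR0 ?mul0r// gt_eqF.
  rewrite powRM ?powR_ge0// -powRrM mulNr mulVf ?gt_eqF// powR_inv1 ?ltW//.
  by rewrite -EFinM mulrA (mulrC (_^-1)%R).
- rewrite (_ : \int[mu]_(s in _) _ =
      \int[mu]_(s in `]0%R, t[) ((j `^ (- p^-1))%:E * phi m s)).
    rewrite ge0_integralZl//; [|exact: mphi|by rewrite lee_fin powR_ge0].
    rewrite -/(J m) Jj -EFinM lee_fin -{2}(powRr1 (ltW j0)) -powRD; last first.
      by rewrite (gt_eqF j0) implybT.
    have -> : (- p^-1 + 1 = (p - 1) / p)%R by field; rewrite gt_eqF.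
    rewrite [leLHS]cE.
    by apply: ge0_ler_powR; rewrite ?nnegrE ?powR_ge0 ?divr_ge0 ?ltW.
  apply: eq_integral => s st; rewrite /f patchE st.
  by rewrite phifin -EFinM mulrC.
Qed.

End hardy_weight.

(** * Stieltjes measures and tails of weights *)

Section lebesgue_stieltjes.
Context {R : realType}.
Implicit Type F : cumulative R R.

Lemma lebesgue_stieltjes_itvoc F (a b : R) : (a <= b)%R ->
  lebesgue_stieltjes_measure F `]a, b] = (F b - F a)%:E.
Proof.
move=> ab; rewrite /lebesgue_stieltjes_measure /measure_extension.
rewrite measurable_mu_extE/=; last exact: is_ocitv.
by rewrite wlength_itv_bnd.
Qed.

Lemma lebesgue_stieltjes_bigcup_le F (a y : R) (s : R^nat) :
  (forall t, 0 <= F t)%R -> nondecreasing_seq s -> (forall n, F (s n) <= y)%R ->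
  lebesgue_stieltjes_measure F (\bigcup_n `]a, s n]%classic) <= y%:E.
Proof.
move=> F0 snd Fy; set mu := lebesgue_stieltjes_measure F.
have mB n : measurable (`]a, s n]%classic : set (measurableTypeR R)).
  exact: measurable_itv.
have cvgB : mu `]a, s n]%classic @[n --> \oo] --> mu (\bigcup_n `]a, s n]%classic).
  apply: nondecreasing_cvg_mu => //; first exact: bigcupT_measurable.
  by move=> m n mn; apply/subsetPset/subset_itvl; rewrite bnd_simp; exact: snd.
rewrite -(cvg_lim _ cvgB)//; apply: lime_le; first by apply/cvg_ex; eexists; exact: cvgB.
apply: nearW => n; have [asn|sna] := leP a (s n).
  rewrite /mu lebesgue_stieltjes_itvoc// lee_fin.
  by rewrite (le_trans _ (Fy n))// gerBl.
rewrite set_itv_ge; last by rewrite bnd_simp -leNgt ltW.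
by rewrite /mu measure0 lee_fin (le_trans _ (Fy n)).
Qed.

(** Exhaustion by the intervals []a, x - 1/(n+1)]] never reaches [x], so a jump of [F] at [x] does
    not count and values before [x] suffice. *)
Lemma lebesgue_stieltjes_itvoo_le F (a x y : R) :
  (forall t, 0 <= F t)%R -> (forall t, t < x -> F t <= y)%R ->
  lebesgue_stieltjes_measure F `]a, x[ <= y%:E.
Proof.
move=> F0 Fy; pose s n := (x - n.+1%:R^-1)%R.
have sx n : (s n < x)%R by rewrite /s ltrBlDr ltrDl invr_gt0.
apply: (@le_trans _ _ (lebesgue_stieltjes_measure F (\bigcup_n `]a, s n]%classic))).
  apply: le_measure; rewrite ?inE.
  - exact: measurable_itv.
  - by apply: bigcupT_measurable => n; exact: measurable_itv.
  move=> t/=; rewrite in_itv/= => /andP[at_ tx].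
  have xt : (0 < x - t)%R by rewrite subr_gt0.
  exists (Num.truncn (x - t)^-1) => //=; rewrite in_itv/= at_/= /s lerBrDr -lerBrDl.
  rewrite -[leRHS]invrK lef_pV2 ?posrE ?invr_gt0//.
  by rewrite ltW// Num.Theory.truncnS_gt.
apply: lebesgue_stieltjes_bigcup_le => // [m n mn|n]; last exact: Fy.
by rewrite /s lerB// lef_pV2 ?posrE// ler_nat ltnS.
Qed.

Lemma lebesgue_stieltjes_itvoy_le F (a y : R) :
  (forall t, 0 <= F t)%R -> (forall t, F t <= y)%R ->
  lebesgue_stieltjes_measure F `]a, +oo[ <= y%:E.
Proof.
move=> F0 Fy; pose s n : R := n%:R.
apply: (@le_trans _ _ (lebesgue_stieltjes_measure F (\bigcup_n `]a, s n]%classic))).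
  apply: le_measure; rewrite ?inE.
  - exact: measurable_itv.
  - by apply: bigcupT_measurable => n; exact: measurable_itv.
  move=> t/=; rewrite in_itv/= andbT => at_.
  by exists (Num.truncn t).+1 => //=; rewrite in_itv/= at_/= ltW// Num.Theory.truncnS_gt.
apply: lebesgue_stieltjes_bigcup_le => // m n mn.
by rewrite /s ler_nat.
Qed.

End lebesgue_stieltjes.

(** * Truncated Stieltjes functions *)

Section truncation.
Context {R : realType}.
Implicit Types (s t : R) (n : nat).
Variable g : R -> \bar R.
Hypothesis g0 : forall t, 0 <= g t.
Hypothesis gnd : {homo g : x y / (x <= y)%R >-> x <= y}.
Hypothesis gneg : forall t : R, (t <= 0)%R -> g t = 0.

Lemma ls_truncEinf n t : (ls_trunc g n t)%:E =
  ereal_inf [set maxe 0 (mine (g s) n%:R%:E) | s in `]t, +oo[%classic].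
Proof.
rewrite fineK// ge0_fin_numE; last first.
  by apply: le_ereal_inf_tmp => _ [s _ <-]; rewrite le_max lexx.
apply: (@le_lt_trans _ _ (maxe 0 (mine (g (t + 1)%R) n%:R%:E))); last first.
  by rewrite gt_max ltry gt_min ltry orbT.
by apply: ereal_inf_lbound; exists (t + 1)%R => //=; rewrite in_itv/= andbT ltrDl.
Qed.

Lemma ls_trunc_ge0 n t : (0 <= ls_trunc g n t)%R.
Proof.
rewrite -lee_fin ls_truncEinf; apply: le_ereal_inf_tmp => _ [s _ <-].
by rewrite le_max lexx.
Qed.

(** With [ls_trunc_ge] this sandwiches the right limit: it dominates [min(g, n)] at the point
    itself, but is dominated by values strictly to the right. This asymmetry is one reason for the
    later shift of the level points. *)
Lemma ls_trunc_le n s t : (s < t)%R ->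
  (ls_trunc g n s)%:E <= mine (g t) n%:R%:E.
Proof.
move=> st; rewrite ls_truncEinf; apply: ereal_inf_lbound; exists t => /=.
  by rewrite in_itv/= st.
by apply/max_idPr; rewrite le_min g0 lee_fin ler0n.
Qed.

Lemma ls_trunc_ge n t : mine (g t) n%:R%:E <= (ls_trunc g n t)%:E.
Proof.
rewrite ls_truncEinf; apply: le_ereal_inf_tmp => _ [s /= + <-].
rewrite in_itv/= andbT => ts; rewrite le_max; apply/orP; right.
by rewrite le_min !ge_min lexx orbT andbT gnd// ltW.
Qed.

Lemma ls_trunc_le_nat n t : (ls_trunc g n t <= n%:R)%R.
Proof.
have := @ls_trunc_le n t (t + 1)%R; rewrite ltrDl ltr01 => /(_ isT).
by rewrite le_min lee_fin => /andP[].
Qed.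

Lemma ls_trunc_lt0 n t : (t < 0)%R -> ls_trunc g n t = 0%R.
Proof.
move=> t0; apply/eqP; rewrite eq_le ls_trunc_ge0 andbT -lee_fin.
apply: (le_trans (ls_trunc_le n t0)).
by rewrite gneg// ge_min lexx.
Qed.

(** The mass of []-1, t]] is the full value [ls_trunc g n t], since the function vanishes at [-1],
    and []-1, 0[] carries none of it. What is left sits in [[0, t]], the atom at 0 included. *)
Lemma ls_trunc_measure_itvcc n t : (0 <= t)%R ->
  mine (g t) n%:R%:E <= lebesgue_stieltjes_measure (ls_trunc g n) `[0%R, t].
Proof.
move=> t0; set mu := lebesgue_stieltjes_measure _.
apply: (le_trans (ls_trunc_ge n t)).
have N10 : (-1 < 0 :> R)%R by rewrite ltrN10.
have -> : (ls_trunc g n t)%:E = mu `](-1)%R, t]%classic.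
  rewrite /mu lebesgue_stieltjes_itvoc ?(le_trans (ltW N10))//.
  by rewrite [X in (_ - X)%R]ls_trunc_lt0 ?subr0 ?ltrN10.
have mu0 : mu `](-1)%R, 0%R[%classic = 0.
  apply/eqP; rewrite eq_le measure_ge0 andbT.
  apply: lebesgue_stieltjes_itvoo_le => s; first exact: ls_trunc_ge0.
  by move=> s0; rewrite [leLHS]ls_trunc_lt0.
rewrite -[leRHS]add0e -mu0; apply: (@le_trans _ _ (mu (`](-1)%R, 0%R[%classic `|` `[0%R, t]%classic))).
  apply: le_measure; rewrite ?inE.
  - exact: measurable_itv.
  - by apply: measurableU; exact: measurable_itv.
  move=> s /=; rewrite !in_itv/= => /andP[-> ->]; rewrite andbT.
  by have [s0|s0] := ltP s 0%R; [left|right].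
by apply: measureU2; exact: measurable_itv.
Qed.

End truncation.

(** * Tails of weights *)

Section hardy_tail.
Context {R : realType}.
Implicit Types (w : R -> R) (t : R).

Lemma hardyW_ge0 w t : nonneg_measurable w -> (0 <= t)%R -> 0 <= hardyW w t.
Proof.
move=> hw t0; apply: integral_ge0 => s; rewrite /= in_itv/= andbT => ts.
by rewrite lee_fin hw.2// (le_lt_trans t0).
Qed.

Lemma measurable_weight w (D : set R) : nonneg_measurable w ->
  measurable D -> D `<=` `]0%R, +oo[ -> measurable_fun D (fun s => (w s)%:E).
Proof.
by move=> [mw _] mD D0; apply/measurable_EFinP; apply: measurable_funS mw.
Qed.

Lemma subset_itvoy (t : R) : (0 <= t)%R -> `]t, +oo[ `<=` (`]0%R, +oo[ : set R).
Proof. by move=> t0 s/=; rewrite !in_itv/= !andbT; exact: le_lt_trans. Qed.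

Lemma integral_le_hardyW w (D : set R) t : nonneg_measurable w -> (0 <= t)%R ->
  measurable D -> D `<=` `]t, +oo[ ->
  \int[lebesgue_measure]_(s in D) (w s)%:E <= hardyW w t.
Proof.
move=> hw t0 mD Dt; apply: ge0_subset_integral => //.
  by apply: measurable_weight => //; exact: subset_itvoy.
move=> s; rewrite /= in_itv/= andbT => ts.
by rewrite lee_fin hw.2// (le_lt_trans t0).
Qed.

Lemma hardyW_ni w s t : nonneg_measurable w -> (0 <= s)%R -> (s <= t)%R ->
  hardyW w t <= hardyW w s.
Proof.
move=> hw s0 st; apply: integral_le_hardyW => // x/=.
by rewrite !in_itv/= !andbT; exact: le_lt_trans.
Qed.

Lemma measurable_hardyW w (e : R) : nonneg_measurable w -> (0 <= e)%R ->
  measurable_fun (`[0%R, +oo[ : set R) (fun t => hardyW w (t + e)).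
Proof.
move=> hw e0.
(* The sign of [w] is unknown on the negative axis, so [hardyW w] is known to be monotone only on
   [[0, oo)]; composing with [max t 0] gives a globally monotone function with the same values
   there. *)
apply: (eq_measurable_fun (fun t => hardyW w (Num.max t 0 + e)%R)).
  by move=> t; rewrite inE/= in_itv/= andbT => t0; rewrite max_l.
apply: nonincreasing_emeasurable => // s t st; apply: hardyW_ni => //.
  by rewrite addr_ge0// le_max lexx orbT.
by rewrite lerD2r ge_max !le_max st/= lexx orbT.
Qed.

(** The half-lines increase to []t, oo[], so monotone convergence covers the value [+oo], which can
    occur at [t = 0]. This removes the shift at the end of the necessity proof. *)
Lemma hardyW_cvg w t : nonneg_measurable w -> (0 <= t)%R ->
  hardyW w (t + n.+1%:R^-1) @[n --> \oo] --> hardyW w t.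
Proof.
move=> hw t0.
have -> : hardyW w t = \int[lebesgue_measure]_(s in
    \bigcup_n `](t + n.+1%:R^-1)%R, +oo[%classic) (w s)%:E.
  congr (integral _ _ _); apply/seteqP; split => s /=; last first.
    move=> [n _ /=]; rewrite !in_itv/= !andbT; apply: le_lt_trans.
    by rewrite lerDl.
  rewrite in_itv/= andbT => ts; have st : (0 < s - t)%R by rewrite subr_gt0.
  exists (Num.truncn (s - t)^-1) => //=; rewrite in_itv/= andbT -ltrBrDl.
  rewrite -[ltRHS]invrK ltf_pV2 ?posrE ?invr_gt0//.
  exact: Num.Theory.truncnS_gt.
apply: ge0_nondecreasing_set_cvg_integral => //.
- move=> m n mn; apply/subsetPset => s /=; rewrite !in_itv/= !andbT; apply: le_lt_trans.
  by rewrite lerD2l lef_pV2 ?posrE// ler_nat ltnS.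
- by move=> n; apply: measurable_weight => //; apply: subset_itvoy; rewrite addr_ge0.
- move=> n s; rewrite /= in_itv/= andbT => h.
  by rewrite lee_fin hw.2// (le_lt_trans _ h)// addr_ge0.
Qed.

Lemma primitive_nd (f : R -> R) : nonneg_measurable f ->
  {homo (fun t : R => \int[lebesgue_measure]_(s in `]0%R, t[) (f s)%:E) :
    x y / (x <= y)%R >-> x <= y}.
Proof.
move=> hf x y xy; apply: ge0_subset_integral => //.
- by apply: measurable_weight => //; exact: subset_itvoo.
- move=> s /subset_itvoo; rewrite /= in_itv/= andbT => s0.
  by rewrite lee_fin hf.2.
- by move=> s/=; rewrite !in_itv/= => /andP[-> sx]; exact: lt_le_trans xy.
Qed.

End hardy_tail.

(** * Sufficiency *)

Section discrete_bound.
Context {R : realType}.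
Variables (v w : R -> R) (p q : R).
Hypotheses (hv : nonneg_measurable v) (hw : nonneg_measurable w).
Hypotheses (hp : (1 <= p)%R) (hq : (0 < q)%R).

Let p0 : (0 < p)%R. Proof. exact: lt_le_trans hp. Qed.

Let b := (p / (p - q))%R.
Let g t := hardyV v p t `^ (p * q / (p - q)).

Let V0 t : 0 <= hardyV v p t. Proof. exact: hardyV_ge0. Qed.

Local Notation ls n := (lebesgue_stieltjes_measure (ls_trunc g n)).

Let g0 t : 0 <= g t. Proof. exact: poweR_ge0. Qed.

Lemma hardyV_powR_nd : (q < p)%R -> {homo g : x y / (x <= y)%R >-> x <= y}.
Proof.
move=> qp x y xy; apply: lee_poweR => //; last exact: hardyV_nd.
by rewrite divr_ge0 ?mulr_ge0 ?subr_ge0 ?ltW.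
Qed.

Lemma hardyV_powR_neg (t : R) : (q < p)%R -> (t <= 0)%R -> g t = 0.
Proof.
move=> qp t0; rewrite /g hardyV_le0// poweR0r//.
by rewrite gt_eqF// divr_gt0 ?mulr_gt0 ?subr_gt0.
Qed.

Let mWb : measurable_fun (`[0%R, +oo[ : set R) (fun t => hardyW w t `^ b).
Proof.
apply: (measurableT_comp (measurable_poweR _)).
apply: eq_measurable_fun (measurable_hardyW hw (lexx 0%R)) => t _.
by rewrite addr0.
Qed.

Lemma integral_le_hardyA n : (q < p)%R ->
  \int[lebesgue_stieltjes_measure (ls_trunc g n)]_(t in `[0%R, +oo[)
    (hardyW w t `^ b) <= hardyA v w p q.
Proof.
by move=> qp; rewrite /hardyA (leNgt p q) qp/=; apply: ereal_sup_ubound; exists n.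
Qed.

(** Exchanging sum and integral makes the claim pointwise in [s], where superadditivity of the power
    [b >= 1] compares the sum of the powers with the power of the sum. The minimum with [n] reflects
    that each integral below [A] uses a truncated measure; the bound is uniform in [n]. *)
Lemma sum_le_hardyA n K (T : R^nat) (E : (set R)^nat) : (q < p)%R ->
  (forall k, 0 <= T k)%R -> (forall k, measurable (E k)) -> trivIset setT E ->
  (forall k, E k `<=` `]T k, +oo[) ->
  \sum_(k < K) mine (g (T k)) n%:R%:E *
     (\int[lebesgue_measure]_(s in E k) (w s)%:E) `^ b <= hardyA v w p q.
Proof.
move=> qp T0 mE tE ET; apply: le_trans (integral_le_hardyA n qp).
have b1 : (1 <= b)%R.
  by rewrite /b ler_pdivlMr ?subr_gt0// mul1r lerBlDr lerDl ltW.
pose W k := \int[lebesgue_measure]_(s in E k) (w s)%:E.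
have E0 k : E k `<=` `]0%R, +oo[.
  exact: subset_trans (@subset_itvoy _ _ (T0 k)).
have wE0 k s : E k s -> 0 <= (w s)%:E.
  by move=> /E0; rewrite /= in_itv/= andbT lee_fin; exact: hw.2.
have W0 k : 0 <= W k by apply: integral_ge0 => s; exact: wE0.
have mI k : measurable (`[0%R, T k]%classic : set (measurableTypeR R)).
  exact: measurable_itv.
have mD : measurable (`[0%R, +oo[%classic : set (measurableTypeR R)).
  exact: measurable_itv.
apply: (@le_trans _ _ (\sum_(k < K) \int[ls n]_(s in `[0%R, +oo[)
    (W k `^ b * (\1_(`[0%R, T k]) s)%:E))).
  apply: lee_sum => k _; rewrite ge0_integralZl ?poweR_ge0//; last first.
    by apply/measurable_EFinP; exact: measurable_indic.
  rewrite muleC lee_wpmul2l ?poweR_ge0// integral_indic//.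
  rewrite setIidl; last by move=> s /=; rewrite !in_itv/= andbT => /andP[].
  apply: ls_trunc_measure_itvcc => //; first exact: hardyV_powR_nd.
  by move=> t; exact: hardyV_powR_neg.
rewrite -ge0_integral_sum//; last 2 first.
- move=> k; apply: emeasurable_funM => //.
  by apply/measurable_EFinP; exact: measurable_indic.
- by move=> k s _; rewrite mule_ge0 ?poweR_ge0// lee_fin.
apply: ge0_le_integral => //.
- by move=> s _; apply: sume_ge0 => k _; rewrite mule_ge0 ?poweR_ge0// lee_fin.
- apply: emeasurable_sum => k; apply: emeasurable_funM => //.
  by apply/measurable_EFinP; exact: measurable_indic.
move=> s; rewrite /= in_itv/= andbT => s0.
(* Emptying [E k] when [T k < s] absorbs the indicator of [[0, T k]] at [s], and the pieces that
   remain all lie in []s, oo[]. *)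
pose E' k := if (s <= T k)%R then E k else set0.
pose W' k := \int[lebesgue_measure]_(s in E' k) (w s)%:E.
have E'E k : E' k `<=` E k by rewrite /E'; case: ifP => _; [exact: subset_refl|exact: sub0set].
have W'0 k : 0 <= W' k by apply: integral_ge0 => x /E'E; exact: wE0.
have mE' k : measurable (E' k) by rewrite /E'; case: ifP.
have E's k : E' k `<=` `]s, +oo[.
  rewrite /E'; case: ifP => [sT x /ET/=|_]; last exact: sub0set.
  by rewrite !in_itv/= !andbT; exact: le_lt_trans.
apply: (@le_trans _ _ (\sum_(k < K) W' k `^ b)).
  apply: lee_sum => k _; rewrite indicE /W' /E' mem_setE in_itv/= s0/=.
  case: ifPn => _; first by rewrite mule1.
  by rewrite mule0 poweR_ge0.
apply: (le_trans (sum_poweR_le _ _ b1 _)) => //.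
apply: lee_poweR; [exact: le_trans b1|exact: sume_ge0|].
apply: (@le_trans _ _ (\sum_(0 <= k <oo) W' k)).
  by rewrite -(big_mkord xpredT W'); exact: nneseries_lim_ge.
rewrite -ge0_integral_bigcup//.
- apply: integral_le_hardyW => //; first exact: bigcupT_measurable.
  by move=> x [k _]; exact: E's.
- apply: measurable_weight => //; first exact: bigcupT_measurable.
  by move=> x [k _] /E'E; exact: E0.
- by move=> x [k _] /E'E; exact: wE0.
- apply/trivIsetP => i j _ _ ij; apply/seteqP; split => // x [/E'E Ei /E'E Ej].
  by move/trivIsetP : tE => /(_ i j Logic.I Logic.I ij) <-.
Qed.

(** Supplies the finiteness that [hardyV_hoelder] requires. For [p <= q] an infinite [V(t)] makes
    the term at [t] infinite. For [q < p] the measure truncated at [n] gives [[0, t]] mass at least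
    [n], and [W >= W(t)] there, so [A >= n W(t)^b] for every [n]. *)
Lemma hardyV_lty (t : R) : hardyA v w p q < +oo -> (0 <= t)%R ->
  0 < hardyW w t -> hardyV v p t < +oo.
Proof.
move=> Aoo t0 Wt; rewrite ltey; apply/eqP => Vt; move: Aoo; apply/negP.
rewrite -leNgt leye_eq; have [pq|qp] := leP p q.
  have tpos : (0 < t)%R.
    rewrite lt_def t0 andbT; apply/eqP => te; move: Vt.
    by rewrite te hardyV_le0.
  rewrite -leye_eq /hardyA pq; apply: ereal_sup_ge; exists (hardyV v p t * hardyW w t `^ q^-1).
    by exists t => //=; rewrite in_itv/= tpos.
  by rewrite Vt gt0_mulye// poweR_gt0.
have gt : g t = +oo.
  by rewrite /g Vt poweRyr// gt_eqF// divr_gt0 ?mulr_gt0 ?subr_gt0.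
have Wb0 : 0 < hardyW w t `^ b by exact: poweR_gt0.
have An (n : nat) : n%:R%:E * hardyW w t `^ b <= hardyA v w p q.
  apply: le_trans (integral_le_hardyA n qp).
    have mI : measurable (`[0%R, t]%classic : set (measurableTypeR R)).
    exact: measurable_itv.
  have mD : measurable (`[0%R, +oo[%classic : set (measurableTypeR R)).
    exact: measurable_itv.
  have sub : `[0%R, t] `<=` (`[0%R, +oo[ : set R).
    by move=> s /=; rewrite !in_itv/= andbT => /andP[].
  apply: (@le_trans _ _ (\int[ls n]_(s in `[0%R, t]) (hardyW w s `^ b))); last first.
    exact: (@ge0_subset_integral _ _ R (ls n) _ _ mI mD _ mWb (fun s _ => poweR_ge0 _ _) sub).
  apply: (@le_trans _ _ (\int[ls n]_(s in `[0%R, t]) (cst (hardyW w t `^ b) s))).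
    rewrite integral_cst// muleC lee_wpmul2l ?(ltW Wb0)//.
    have := @ls_trunc_measure_itvcc _ g g0 (hardyV_powR_nd qp)
      (fun t => hardyV_powR_neg qp) n t t0.
    by rewrite gt min_r ?leey.
  apply: ge0_le_integral => //.
  - by move=> s _; exact: poweR_ge0.
  - exact: measurable_funS mWb.
  move=> s /=; rewrite in_itv/= => /andP[s0 st]; apply: lee_poweR.
  - by rewrite divr_ge0 ?subr_ge0 ?ltW.
  - exact: hardyW_ge0.
  - exact: hardyW_ni.
case: (hardyA v w p q) An => [a| |] An; last 2 first.
- by [].
- have := An 0%N; rewrite mul0e leeNy_eq => /eqP//.
case: (hardyW w t `^ b) Wb0 An => [c| |]//; last first.
  by move=> _ /(_ 1%N); rewrite mul1e.
rewrite lte_fin => c0 An; have := An (Num.truncn (a / c)).+1.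
rewrite -EFinM lee_fin -ler_pdivlMr// leNgt.
by rewrite Num.Theory.truncnS_gt.
Qed.

(** Here [a k] stands for the share of the integral of [f^p v] in a block; letting [a] range over
    all sequences of total at most 1 detaches the constant from [f]. The constant is [A^q] if
    [p <= q], where [a^(q/p) <= a], and [A + 1] if [q < p], one summand for each term of Young's
    inequality. *)
Lemma discrete_bound : hardyA v w p q < +oo ->
  exists M : R, (0 <= M)%R /\
  forall (T : R^nat) (E : (set R)^nat) (a : (\bar R)^nat) (K : nat),
    (forall k, 0 < T k)%R -> (forall k, measurable (E k)) -> trivIset setT E ->
    (forall k, E k `<=` `]T k, +oo[) ->
    (forall k, 0 <= a k) -> (forall K, \sum_(k < K) a k <= 1) ->
    \sum_(k < K) (hardyV v p (T k) * a k `^ p^-1) `^ q *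
      \int[lebesgue_measure]_(s in E k) (w s)%:E <= M%:E.
Proof.
move=> Aoo.
have a_le1 (a : (\bar R)^nat) : (forall k, 0 <= a k) ->
    (forall K, \sum_(k < K) a k <= 1) -> forall k, a k <= 1.
  move=> a0 a1 k; apply: le_trans (a1 k.+1); rewrite big_ord_recr/=.
  by rewrite leeDr// sume_ge0.
have [pq|qp] := leP p q.
  have VW t : (0 < t)%R -> hardyV v p t * hardyW w t `^ q^-1 <= hardyA v w p q.
    move=> t0; rewrite /hardyA pq; apply: ereal_sup_ubound; exists t => //=.
    by rewrite in_itv/= t0.
  have A0 : 0 <= hardyA v w p q.
    by apply: le_trans (VW 1%R ltr01); rewrite mule_ge0 ?poweR_ge0.
  have Afin : hardyA v w p q \is a fin_num by rewrite ge0_fin_numE.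
  exists (fine (hardyA v w p q) `^ q)%R; split; first exact: powR_ge0.
  move=> T E a K T0 mE tE ET a0 a1; rewrite -poweR_EFin fineK//.
  apply: (@le_trans _ _ (\sum_(k < K) (hardyA v w p q `^ q * a k))); last first.
    by rewrite -ge0_sume_distrr// -[leRHS]mule1 lee_wpmul2l ?poweR_ge0.
  apply: lee_sum => k _; rewrite poweRM ?poweR_ge0// -muleA.
  rewrite [a k `^ _ `^ _ * _]muleC muleA.
  have w0 : 0 <= \int[lebesgue_measure]_(s in E k) (w s)%:E.
    apply: integral_ge0 => s /ET; rewrite /= in_itv/= andbT => Ts.
    by rewrite lee_fin hw.2// (lt_trans _ Ts).
  apply: lee_pmul; rewrite ?mule_ge0 ?poweR_ge0//.
    apply: (@le_trans _ _ ((hardyV v p (T k) * hardyW w (T k) `^ q^-1) `^ q)).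
      rewrite poweRM ?poweR_ge0// lee_wpmul2l ?poweR_ge0//.
      rewrite poweRVK// ?hardyW_ge0// ?(ltW (T0 k))//.
      by apply: integral_le_hardyW => //; exact: ltW.
    apply: lee_poweR; rewrite ?mule_ge0 ?poweR_ge0 ?(ltW hq)//.
    exact: VW.
  rewrite -poweRrM; apply: lee_poweR_le1 => //; last exact: a_le1.
  by rewrite mulrC ler_pdivlMr// mul1r.
have A0 : 0 <= hardyA v w p q.
  apply: le_trans (integral_le_hardyA 0 qp).
  by apply: integral_ge0 => s _; exact: poweR_ge0.
have Afin : hardyA v w p q \is a fin_num by rewrite ge0_fin_numE.
exists (fine (hardyA v w p q) + 1)%R; split; first by rewrite addr_ge0// fine_ge0.
move=> T E a K T0 mE tE ET a0 a1; rewrite EFinD fineK//.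
set W := fun k => \int[lebesgue_measure]_(s in E k) (w s)%:E.
have W0 k : 0 <= W k.
  apply: integral_ge0 => s /ET; rewrite /= in_itv/= andbT => Ts.
  by rewrite lee_fin hw.2// (lt_trans _ Ts).
have b0 : (0 < b)%R by rewrite divr_gt0 ?subr_gt0.
have pq0 : (0 < p / q)%R by rewrite divr_gt0.
have bpq : (b^-1 + (p / q)^-1 = 1)%R.
  by rewrite /b !invf_div; field; rewrite gt_eqF.
apply: (@le_trans _ _ (\sum_(k < K) (g (T k) * W k `^ b + a k))).
  apply: lee_sum => k _; rewrite poweRM ?poweR_ge0// -muleA.
  rewrite [a k `^ _ `^ _ * _]muleC muleA.
  apply: (le_trans (crude_young _ _ b0 pq0 bpq)).
  - exact: mule_ge0 (poweR_ge0 _ _) (W0 k).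
  - exact: poweR_ge0.
  rewrite (poweRM _ (poweR_ge0 _ _) (W0 k)) -!poweRrM.
  rewrite [X in X * _](_ : _ = g (T k)); last first.
    by rewrite /g /b; congr (_ `^ _); ring.
  rewrite leeD2l//.
    by rewrite (_ : p^-1 * _ = 1)%R ?poweRe1//; field; rewrite !gt_eqF.
rewrite big_split/=; apply: leeD; last exact: a1.
(* Only finitely many blocks occur, so one level [n] exceeds every finite [g (T k)] and the minimum
   becomes inactive. Where [g (T k)] is infinite, [W k = 0] and the term vanishes. *)
pose n := \max_(k < K) (Num.truncn (fine (g (T k)))).+1.
apply: le_trans (@sum_le_hardyA n K T E qp _ mE tE ET); last first.
  by move=> k; exact: ltW.
apply: lee_sum => k _; have [Wk|Wk] := eqVneq (W k) 0.
  by rewrite -/(W k) Wk poweR0r ?gt_eqF// !mule0.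
rewrite lee_wpmul2r ?poweR_ge0// le_min lexx/=.
have gfin : g (T k) \is a fin_num.
  rewrite ge0_fin_numE// poweR_lty// hardyV_lty ?(ltW (T0 k))//.
  apply: (@lt_le_trans _ _ (W k)); first by rewrite lt_def Wk W0.
  by apply: integral_le_hardyW => //; exact: ltW.
rewrite -(fineK gfin) lee_fin (le_trans (ltW (Num.Theory.truncnS_gt _)))//.
by rewrite ler_nat (leq_bigmax k).
Qed.

End discrete_bound.

(** * Bounded functions with bounded support *)

Section bounded_sufficiency.
Context {R : realType}.
Local Notation mu := (@lebesgue_measure R).
Variables (f : R -> R) (m : R).
Hypotheses (m0 : (0 < m)%R) (mf : measurable_fun [set: R] f).
Hypotheses (f0 : forall s, (0 <= f s)%R) (fm : forall s, (f s <= m)%R).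
Hypothesis fsupp : forall s, ~ `]0%R, m[%classic s -> f s = 0%R.

Local Notation h t := (\int[mu]_(s in `]0%R, t[) (f s)%:E).

Let mfE (D : set R) : measurable D -> measurable_fun D (fun s => (f s)%:E).
Proof. by move=> mD; apply/measurable_EFinP; exact: (measurable_funS measurableT). Qed.

Let int0 (D : set R) : 0 <= \int[mu]_(s in D) (f s)%:E.
Proof. by apply: integral_ge0 => s _; rewrite lee_fin. Qed.

Let hf : nonneg_measurable f.
Proof. by split => //; exact: (measurable_funS measurableT). Qed.

Let h_le t : h t <= h m.
Proof.
rewrite (_ : h t = \int[mu]_(s in `]0%R, t[ `&` `]0%R, m[) (f s)%:E); last first.
  rewrite integral_mkcondr; apply: eq_integral => s _; rewrite patchE.
  by case: ifPn => //; rewrite notin_setE => /fsupp ->.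
by apply: ge0_subset_integral => //;
  [exact: measurableI|exact: mfE|move=> s _; rewrite lee_fin].
Qed.

Let int_bound (x y : R) : (x <= y)%R ->
  \int[mu]_(s in `[x, y[) (f s)%:E <= (m * (y - x))%:E.
Proof.
move=> xy; apply: (@le_trans _ _ (\int[mu]_(s in `[x, y[) (cst m%:E s))).
  apply: ge0_le_integral => //; first by move=> s _; rewrite lee_fin.
    exact: mfE.
  by move=> s _; rewrite lee_fin.
rewrite integral_cst// EFinM lee_wpmul2l ?lee_fin ?(ltW m0)//.
rewrite [leLHS]lebesgue_measure_itv/= lte_fin; case: ifPn => //.
by rewrite lee_fin subr_ge0.
Qed.

Lemma primitive_split (x y : R) : (0 < x <= y)%R ->
  h y = h x + \int[mu]_(s in `[x, y[) (f s)%:E.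
Proof.
move=> /andP[x0 xy]; rewrite -ge0_integral_setU//.
- congr (integral _ _ _); apply/seteqP; split => s /=.
    rewrite !in_itv/= => /andP[s0 sy]; have [sx|xs] := ltP s x.
      by left; rewrite s0.
    by right.
  rewrite !in_itv/= => -[/andP[s0 sx]|/andP[xs sy]].
    by rewrite s0 (lt_le_trans sx).
  by rewrite sy (lt_le_trans x0).
- by apply: mfE; exact: measurableU.
- by move=> s _; rewrite lee_fin.
- apply/disj_setPS => s [] /=; rewrite !in_itv/= => /andP[_ sx] /andP[xs _].
  by have := lt_le_trans sx xs; rewrite ltxx.
Qed.

Let h0 (t : R) : (t <= 0)%R -> h t = 0.
Proof.
move=> t0; rewrite set_itv_ge ?integral_set0//.
by rewrite bnd_simp -leNgt.
Qed.

Let hfin t : h t \is a fin_num.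
Proof.
rewrite ge0_fin_numE//; have [t0|t0] := leP t 0%R; first by rewrite h0 ?ltry.
apply: (@le_lt_trans _ _ (\int[mu]_(s in `[0%R, t[) (f s)%:E)).
  apply: ge0_subset_integral => //; first exact: mfE.
    by move=> s _; rewrite lee_fin.
  by apply: subset_itvr; rewrite bnd_simp.
by apply: (le_lt_trans (int_bound (ltW t0))); rewrite ltry.
Qed.

Let hr t := fine (h t).

Let hrE t : h t = (hr t)%:E. Proof. by rewrite /hr fineK. Qed.

Let hr_nd : nondecreasing hr.
Proof. by move=> x y xy; rewrite -lee_fin -!hrE; exact: primitive_nd. Qed.

(** The slope is the bound [m] of [f]. This yields the continuity used to find the cut points by the
    intermediate value theorem. *)
Let hr_lip x y : (x <= y)%R -> (hr y - hr x <= m * (y - x))%R.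
Proof.
move=> xy; have [x0|x0] := ltP 0%R x.
  have : h y = h x + \int[mu]_(s in `[x, y[) (f s)%:E.
    by apply: primitive_split; rewrite x0.
  rewrite !hrE => hyx; rewrite -lee_fin EFinB hyx addeAC subee// add0e.
  exact: int_bound.
rewrite {2}/hr (h0 x0) subr0 -lee_fin -hrE.
have [y0|y0] := leP y 0%R.
  by rewrite h0// lee_fin mulr_ge0 ?(ltW m0)// subr_ge0.
apply: (@le_trans _ _ (\int[mu]_(s in `[0%R, y[) (f s)%:E)).
  apply: ge0_subset_integral => //; first exact: mfE.
    by move=> s _; rewrite lee_fin.
  by apply: subset_itvr; rewrite bnd_simp.
apply: (le_trans (int_bound (ltW y0))).
by rewrite lee_fin ler_pM2l// lerD2l lerN2.
Qed.

Let hr_cont : continuous hr.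
Proof.
move=> x; apply/cvgrPdist_lt => e e0; near=> y.
have yx : (`|x - y| < e / m)%R.
  by near: y; apply: cvgr_dist_lt => //; rewrite divr_gt0.
rewrite ltr_pdivlMr// in yx; apply: le_lt_trans yx; rewrite mulrC.
have [xy|/ltW yx] := leP x y.
  by rewrite distrC (distrC x) !ger0_norm ?subr_ge0 ?hr_nd//; exact: hr_lip.
by rewrite !ger0_norm ?subr_ge0 ?hr_nd//; exact: hr_lip.
Unshelve. all: by end_near. Qed.

Let H := hr m.

Let level (k : nat) : (0 < H)%R ->
  exists T, [/\ (0 < T)%R, (T <= m)%R & hr T = (H / 2 ^+ k)%R].
Proof.
move=> H0; have hr0 : hr 0 = 0%R by rewrite /hr h0.
have lev0 : (0 < H / 2 ^+ k)%R by rewrite divr_gt0// exprn_gt0.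
have [||T] := @IVT R hr 0%R m (H / 2 ^+ k)%R (ltW m0).
- by apply: continuous_subspaceT => x; exact: hr_cont.
- rewrite hr0 min_l ?(ltW H0)// max_r ?(ltW H0)// (ltW lev0)/=.
  by rewrite ler_pdivrMr ?exprn_gt0// ler_peMr ?(ltW H0)// exprn_ege1// ler1n.
rewrite in_itv/= => /andP[T0 Tm] hT; exists T; split => //.
rewrite lt_def T0 andbT; apply/eqP => Te.
by move: lev0; rewrite -hT Te hr0 ltxx.
Qed.

Variables (v w : R -> R) (p q M : R).
Hypotheses (hv : nonneg_measurable v) (hw : nonneg_measurable w).
Hypotheses (hp : (1 <= p)%R) (hq : (0 < q)%R) (M0 : (0 <= M)%R).
Hypothesis Vfin : forall t : R, (0 <= t)%R -> 0 < hardyW w t ->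
  hardyV v p t < +oo.
Hypothesis Mbound :
  forall (T : R^nat) (E : (set R)^nat) (a : (\bar R)^nat) (K : nat),
    (forall k, 0 < T k)%R -> (forall k, measurable (E k)) -> trivIset setT E ->
    (forall k, E k `<=` `]T k, +oo[) ->
    (forall k, 0 <= a k) -> (forall K, \sum_(k < K) a k <= 1) ->
    \sum_(k < K) (hardyV v p (T k) * a k `^ p^-1) `^ q *
      \int[mu]_(s in E k) (w s)%:E <= M%:E.
Hypothesis fpv : \int[mu]_(s in `]0%R, +oo[) (f s `^ p * v s)%:E <= 1.

Let mhw (D : set R) : measurable D -> D `<=` `]0%R, +oo[ ->
  measurable_fun D (fun t => (h t) `^ q * (w t)%:E).
Proof.
move=> mD D0; apply: emeasurable_funM; last exact: measurable_weight.
apply: (measurableT_comp (measurable_poweR _)).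
by apply: nondecreasing_emeasurable => //; exact: primitive_nd.
Qed.

(* With [h(T_k) = 2 ^- k h(oo)] and [E_k] the set where [h] lies between
   [h(T_(k+1))] and [h(T_k)], on [E_k] one has [h <= 4 (h(T_(k+1)) - h(T_(k+2)))],
   an integral over [[T_(k+2), T_(k+1)[] to which Hoelder's inequality applies. *)
Lemma bounded_sufficiency :
  \int[mu]_(t in `]0%R, +oo[) ((h t) `^ q * (w t)%:E) <= (4 `^ q * M)%:E.
Proof.
have K0 : (0 <= 4 `^ q * M)%R by rewrite mulr_ge0 ?powR_ge0.
have H0 : (0 <= H)%R by rewrite fine_ge0.
rewrite le_eqVlt in H0; case/predU1P : H0 => [H0|H0].
  rewrite integral0_eq ?lee_fin// => t _.
  have -> : h t = 0.
    by apply/eqP; rewrite eq_le int0 (le_trans (h_le t))// hrE -/H -H0.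
  by rewrite poweR0r ?gt_eqF// mul0e.
have /choice[T Tk] := fun k => level k H0.
have T0 k : (0 < T k)%R by have [] := Tk k.
have hT k : hr (T k) = (H / 2 ^+ k)%R by have [] := Tk k.
have H2 k : (H / 2 ^+ k.+1 < H / 2 ^+ k)%R.
  by rewrite ltr_pM2l// ltf_pV2 ?posrE ?exprn_gt0// ltr_eXn2l ?ltr1n.
have H2le i j : (i <= j)%N -> (H / 2 ^+ j <= H / 2 ^+ i)%R.
  by move=> ij; rewrite ler_pM2l// lef_pV2 ?posrE ?exprn_gt0// ler_eXn2l ?ltr1n.
have Tlt x y : (hr x < hr y)%R -> (x < y)%R.
  by rewrite !ltNge; apply: contra; exact: hr_nd.
have Tdec i j : (i <= j)%N -> (T j <= T i)%R.
  rewrite leq_eqVlt => /predU1P[->//|ij]; apply/ltW/Tlt; rewrite !hT.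
  exact: le_lt_trans (H2le _ _ ij) (H2 _).
pose E k := `]0%R, +oo[ `&` hr @^-1` `](H / 2 ^+ k.+1)%R, (H / 2 ^+ k)%R].
have mE k : measurable (E k).
  by apply: (nondecreasing_measurable _ hr_nd).
have mE' k : measurable (E k : set (measurableTypeR R)) by exact: mE.
have E0 k : E k `<=` `]0%R, +oo[ by move=> t [].
have tE : trivIset setT E.
  apply/trivIsetP => i j _ _; wlog ij : i j / (i < j)%N.
    move=> wl; rewrite neq_ltn => /orP[ij|ji]; first by apply: wl => //; rewrite ltn_eqF.
    by rewrite setIC; apply: wl => //; rewrite ltn_eqF.
  move=> _; apply/seteqP; split => // t [[_ /=] + [_ /=]].
  rewrite !in_itv/= => /andP[it _] /andP[_ tj].
  by have := lt_le_trans it (le_trans tj (H2le _ _ ij)); rewrite ltxx.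
have ET k : E k `<=` `]T k.+1, +oo[.
  move=> t [_ /=]; rewrite !in_itv/= andbT => /andP[tk _].
  by apply: Tlt; rewrite hT.
pose D k := `[T k.+2, T k.+1[%classic : set R.
have D0 k : D k `<=` `]0%R, +oo[.
  by move=> t /=; rewrite !in_itv/= andbT => /andP[+ _]; exact: lt_le_trans (T0 _).
have mD k : measurable (D k) by exact: measurable_itv.
have tD : trivIset setT D.
  apply/trivIsetP => i j _ _; wlog ij : i j / (i < j)%N.
    move=> wl; rewrite neq_ltn => /orP[ij|ji]; first by apply: wl => //; rewrite ltn_eqF.
    by rewrite setIC; apply: wl => //; rewrite ltn_eqF.
  move=> _; apply/seteqP; split => // t [].
  rewrite /D/= !in_itv/= => /andP[it _] /andP[_ tj].
  by have := lt_le_trans tj (le_trans (Tdec i.+2 j.+1 ij) it); rewrite ltxx.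
pose a k := \int[mu]_(s in D k) (f s `^ p * v s)%:E.
have fv0 s : `]0%R, +oo[%classic s -> 0 <= (f s `^ p * v s)%:E.
  by rewrite /= in_itv/= andbT => s0; rewrite lee_fin mulr_ge0 ?powR_ge0// hv.2.
have a0 k : 0 <= a k by apply: integral_ge0 => s /D0; exact: fv0.
have a1 K : \sum_(k < K) a k <= 1.
  rewrite -(big_mkord xpredT a); apply: (le_trans (nneseries_lim_ge _ _)) => //.
  rewrite -ge0_integral_bigcup//.
  - apply: le_trans fpv; apply: ge0_subset_integral => //.
    + exact: bigcupT_measurable.
    + exact: measurable_powRw.
    + by move=> s [k _]; exact: D0.
  - apply: measurable_powRw => //; first exact: bigcupT_measurable.
    by move=> s [k _]; exact: D0.
  - by move=> s [k _] /D0; exact: fv0.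
have hw0 s : `]0%R, +oo[%classic s -> 0 <= (w s)%:E.
  by rewrite /= in_itv/= andbT => s0; rewrite lee_fin hw.2.
have hE k : \int[mu]_(t in E k) ((h t) `^ q * (w t)%:E) <=
    (4 `^ q)%:E * ((hardyV v p (T k.+1) * a k `^ p^-1) `^ q *
      \int[mu]_(s in E k) (w s)%:E).
  apply: (@le_trans _ _ (\int[mu]_(t in E k)
      (((4 * (H / 2 ^+ k.+2))`^ q)%:E * (w t)%:E))).
    apply: ge0_le_integral => //.
    - by move=> t /E0 Et; rewrite mule_ge0 ?poweR_ge0// hw0.
    - exact: mhw.
    - by apply: emeasurable_funM => //; exact: measurable_weight.
    move=> t Et; rewrite lee_wpmul2r ?(hw0 _ (E0 _ _ Et))//.
    rewrite hrE poweR_EFin lee_fin; apply: ge0_ler_powR.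
    - exact: ltW.
    - by rewrite nnegrE fine_ge0.
    - by rewrite nnegrE mulr_ge0// divr_ge0 ?exprn_ge0// ltW.
    case: Et => _ /=; rewrite in_itv/= => /andP[_ /le_trans]; apply.
    rewrite !exprS; have : (2 ^+ k != 0 :> R)%R by rewrite expf_neq0.
    by move=> k0; rewrite le_eqVlt; apply/orP; left; apply/eqP; field.
  rewrite ge0_integralZl//; last 3 first.
  - exact: measurable_weight.
  - by move=> s /E0; exact: hw0.
  - by rewrite lee_fin powR_ge0.
  set Wk := \int[mu]_(t in E k) (w t)%:E.
  have Wk0 : 0 <= Wk by apply: integral_ge0 => s /E0; exact: hw0.
  have [->|Wkn0] := eqVneq Wk 0; first by rewrite !mule0.
  have VT : hardyV v p (T k.+1) < +oo.
    apply: Vfin; first exact: ltW.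
    apply: (@lt_le_trans _ _ Wk); first by rewrite lt_def Wkn0.
    by apply: integral_le_hardyW => //; exact: ltW.
  rewrite powRM// ?divr_ge0 ?exprn_ge0 ?(ltW H0)// EFinM -muleA.
  rewrite lee_wpmul2l ?lee_fin ?powR_ge0// lee_wpmul2r//.
  rewrite -poweR_EFin; apply: lee_poweR.
  - exact: ltW.
  - by rewrite lee_fin divr_ge0 ?exprn_ge0 ?(ltW H0).
  have -> : (H / 2 ^+ k.+2)%:E = \int[mu]_(s in D k) (f s)%:E.
    have := @primitive_split (T k.+2) (T k.+1).
    rewrite T0 Tdec// => /(_ isT); rewrite hrE (hrE (T k.+2)) !hT => /esym.
    rewrite -/(D k) => hk; rewrite -[RHS]add0e -[X in X + _](subee (x := (H / 2 ^+ k.+2)%:E))//.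
    rewrite addeAC hk -EFinB; congr EFin; rewrite !exprS.
    have : (2 ^+ k != 0 :> R)%R by rewrite expf_neq0.
    by move=> k0; field.
  apply: hardyV_hoelder => //.
  by move=> s; rewrite /D/= !in_itv/= => /andP[Ts ->]; rewrite (lt_le_trans _ Ts).
have -> : \int[mu]_(t in `]0%R, +oo[) ((h t) `^ q * (w t)%:E) =
    \int[mu]_(t in \bigcup_k E k) ((h t) `^ q * (w t)%:E).
  have -> : \bigcup_k E k = `]0%R, +oo[ `&` \bigcup_k E k.
    by apply/esym/setIidr => t [k _]; exact: E0.
  rewrite integral_mkcondr; apply: eq_integral => t; rewrite inE => t0.
  rewrite patchE; case: ifPn => //; rewrite notin_setE => nE.
  have [->|ht] := eqVneq (h t) 0; first by rewrite poweR0r ?gt_eqF// mul0e.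
  exfalso; apply: nE.
  have ht0 : (0 < hr t)%R by rewrite -lte_fin -hrE lt_def ht int0.
  have exk : exists k, (H / 2 ^+ k.+1 < hr t)%R.
    exists (Num.truncn (H / hr t)); rewrite ltr_pdivrMr ?exprn_gt0// mulrC.
    rewrite -ltr_pdivrMr//; apply: (lt_trans (Num.Theory.truncnS_gt _)).
    by rewrite -natrX ltr_nat ltn_expl.
  (* Minimality of [k] provides the upper end of the value interval; for [k = 0] that end is
     [h t <= h m]. *)
  case: (ex_minnP exk) => k kt kmin; exists k => //; split => //=.
  rewrite in_itv/= kt/=; case: k kt kmin => [|k] kt kmin.
    by rewrite expr0 divr1 -lee_fin -!hrE; exact: h_le.
  by rewrite leNgt; apply/negP => /kmin; rewrite ltnn.
rewrite ge0_integral_bigcup//; last 2 first.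
- apply: mhw; first exact: bigcupT_measurable.
  by move=> t [k _]; exact: E0.
- by move=> t [k _] /E0 t0; rewrite mule_ge0 ?poweR_ge0// hw0.
have ihw0 k : 0 <= \int[mu]_(t in E k) ((h t) `^ q * (w t)%:E).
  by apply: integral_ge0 => t /E0 t0; rewrite mule_ge0 ?poweR_ge0// hw0.
apply: lime_le; first by apply: is_cvg_nneseries => k _ _; exact: ihw0.
apply: nearW => K; rewrite big_mkord.
apply: (@le_trans _ _ (\sum_(k < K) (4 `^ q)%:E *
    ((hardyV v p (T k.+1) * a k `^ p^-1) `^ q * \int[mu]_(s in E k) (w s)%:E))).
  by apply: lee_sum => k _; exact: hE.
rewrite -ge0_sume_distrr; last first.
  move=> k _; rewrite mule_ge0 ?poweR_ge0//.
  by apply: integral_ge0 => t /E0; exact: hw0.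
rewrite EFinM lee_wpmul2l ?lee_fin ?powR_ge0//.
(* The cut point attached to block [k] is [T (k + 1)]: [D k] lies to its left and [E k] to its
   right. *)
exact: (Mbound K (fun k => T0 k.+1) mE tE ET a0 a1).
Qed.

End bounded_sufficiency.

(** * Passage to arbitrary functions by monotone convergence and scaling *)

(** Monotonicity turns the limits into suprema, and the inverse power carries an upper bound of the
    powers back to the [u n], whether or not the values are finite. *)
Lemma poweR_cvg_nondecreasing {R : realType} (u : (\bar R)^nat) (l : \bar R) (r : R) :
  (0 < r)%R -> (forall n, 0 <= u n) -> nondecreasing_seq u ->
  u n @[n --> \oo] --> l -> u n `^ r @[n --> \oo] --> l `^ r.
Proof.
move=> r0 u0 und ul; have ule n : u n <= l.
  rewrite -(cvg_lim _ ul)//; apply: lime_ge; first by apply/cvg_ex; exists l.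
  by exists n => // m; exact: und.
have cu : u n `^ r @[n --> \oo] --> ereal_sup (range (fun n => u n `^ r)).
  by apply: ereal_nondecreasing_cvgn => m n mn; apply: lee_poweR (und _ _ mn) => //; exact: ltW.
have -> // : l `^ r = ereal_sup (range (fun n => u n `^ r)).
apply/eqP; rewrite eq_le; apply/andP; split; last first.
  by apply: ge_ereal_sup => _ [n _ <-]; apply: lee_poweR => //; exact: ltW.
set s := ereal_sup _; have us n : u n `^ r <= s by apply: ereal_sup_ubound; exists n.
have s0 : 0 <= s by apply: le_trans (us 0%N); exact: poweR_ge0.
rewrite -[leRHS](poweRVK r0 s0); apply: lee_poweR; [exact: ltW| |].
  exact: le_trans (ule 0%N).
rewrite -(cvg_lim _ ul)//; apply: lime_le; first by apply/cvg_ex; exists l.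
apply: nearW => n; rewrite -(poweRK r0 (u0 n)); apply: lee_poweR => //.
  by rewrite invr_ge0 ltW.
exact: poweR_ge0.
Qed.

Lemma cvg_integral_nondecreasing d (T : measurableType d) (R : realType)
    (nu : {measure set T -> \bar R}) (D : set T) (u : nat -> T -> \bar R)
    (l : T -> \bar R) :
  measurable D -> (forall n, measurable_fun D (u n)) ->
  (forall n x, D x -> 0 <= u n x) ->
  (forall x, D x -> nondecreasing_seq (u ^~ x)) ->
  (forall x, D x -> u n x @[n --> \oo] --> l x) ->
  \int[nu]_(x in D) u n x @[n --> \oo] --> \int[nu]_(x in D) l x.
Proof.
move=> mD mu u0 und ul.
rewrite (_ : \int[nu]_(x in D) l x = \int[nu]_(x in D) limn (u ^~ x)).
  exact: cvg_monotone_convergence.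
by apply: eq_integral => x; rewrite inE => Dx; apply/esym/cvg_lim => //; exact: ul.
Qed.

Section sufficiency.
Context {R : realType}.
Local Notation mu := (@lebesgue_measure R).
Variables (v w : R -> R) (p q : R).
Hypotheses (hv : nonneg_measurable v) (hw : nonneg_measurable w).
Hypotheses (hp : (1 <= p)%R) (hq : (0 < q)%R).

Let p0 : (0 < p)%R. Proof. exact: lt_le_trans hp. Qed.

Local Notation h f t := (\int[mu]_(s in `]0%R, t[) (f s)%:E).
Local Notation L f :=
  (\int[mu]_(t in `]0%R, +oo[) ((h f t) `^ q * (w t)%:E)).
Local Notation I f := (\int[mu]_(t in `]0%R, +oo[) (f t `^ p * v t)%:E).

Lemma hardy_normalized M : (0 <= M)%R ->
  (forall t : R, (0 <= t)%R -> 0 < hardyW w t -> hardyV v p t < +oo) ->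
  (forall (T : R^nat) (E : (set R)^nat) (a : (\bar R)^nat) (K : nat),
    (forall k, 0 < T k)%R -> (forall k, measurable (E k)) -> trivIset setT E ->
    (forall k, E k `<=` `]T k, +oo[) ->
    (forall k, 0 <= a k) -> (forall K, \sum_(k < K) a k <= 1) ->
    \sum_(k < K) (hardyV v p (T k) * a k `^ p^-1) `^ q *
      \int[mu]_(s in E k) (w s)%:E <= M%:E) ->
  forall f : R -> R, nonneg_measurable f -> I f <= 1 -> L f <= (4 `^ q * M)%:E.
Proof.
move=> M0 Vfin Mbound f hf If.
(* The single number [n + 1] bounds both the height and the support, as the bounded case demands,
   and is positive from [n = 0] on. *)
pose F (n : nat) := (fun s => Num.min (f s) n.+1%:R) \_ `]0%R, n.+1%:R[.
have F0 n s : (0 <= F n s)%R.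
  rewrite /F patchE; case: ifPn => //; rewrite inE/= in_itv/= => /andP[s0 _].
  by rewrite le_min hf.2// ler0n.
have Fn n s : (F n s <= n.+1%:R)%R.
  by rewrite /F patchE; case: ifPn => // _; rewrite ge_min lexx orbT.
have Ff n s : (0 < s)%R -> (F n s <= f s)%R.
  move=> s0; rewrite /F patchE; case: ifPn => _; last exact: hf.2.
  by rewrite ge_min lexx.
have Fnd s : (0 < s)%R -> nondecreasing_seq (fun n => F n s).
  move=> s0 m n mn; rewrite /F !patchE.
  have mn' : (m.+1%:R <= n.+1%:R :> R)%R by rewrite ler_nat.
  case: ifPn => [|_]; last by case: ifPn => // _; rewrite le_min hf.2// ler0n.
  rewrite inE/= in_itv/= => /andP[_ sm]; rewrite mem_set/=; last first.
    by rewrite in_itv/= s0 (lt_le_trans sm).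
  by rewrite le_min !ge_min lexx mn' orbT.
have Fcvg s : (0 < s)%R -> (F n s)%:E @[n --> \oo] --> (f s)%:E.
  move=> s0; apply: cvg_near_cst; near=> n; congr EFin.
  have nf : (f s <= n.+1%:R)%R.
    apply: (@le_trans _ _ n%:R%R); last by rewrite ler_nat.
    by near: n; exact: nbhs_infty_ger.
  have ns : (s < n.+1%:R)%R.
    apply: (@le_lt_trans _ _ n%:R%R); last by rewrite ltr_nat.
    by near: n; exact: nbhs_infty_ger.
  by rewrite /F patchE mem_set ?min_l//= in_itv/= s0.
have mF n : measurable_fun [set: R] (F n).
  have mI : measurable (`]0%R, n.+1%:R[ : set R) by [].
  apply/(measurable_restrictT _ mI); apply: measurable_minr => //.
  by apply: measurable_funS hf.1 => //; exact: subset_itvoo.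
have hF n : nonneg_measurable (F n).
  by split => //; exact: (measurable_funS measurableT).
have mFE n (D : set R) : measurable D -> measurable_fun D (fun s => (F n s)%:E).
  by move=> mD; apply/measurable_EFinP; exact: (measurable_funS measurableT).
have hcvg t : h (F n) t @[n --> \oo] --> h f t.
  apply: cvg_integral_nondecreasing => //.
  - by move=> n; exact: mFE.
  - by move=> n s _; rewrite lee_fin.
  - move=> s /subset_itvoo; rewrite /= in_itv/= andbT => s0 m n mn.
    by rewrite lee_fin Fnd.
  - by move=> s /subset_itvoo; rewrite /= in_itv/= andbT; exact: Fcvg.
have hF0 n t : 0 <= h (F n) t by apply: integral_ge0 => s _; rewrite lee_fin.
have hFnd t : nondecreasing_seq (fun n => h (F n) t).
  move=> m n mn; apply: ge0_le_integral => //.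
  - by move=> s _; rewrite lee_fin.
  - exact: mFE.
  - exact: mFE.
  by move=> s /subset_itvoo; rewrite /= in_itv/= andbT => s0; rewrite lee_fin Fnd.
have w0 t : `]0%R, +oo[%classic t -> 0 <= (w t)%:E.
  by rewrite /= in_itv/= andbT lee_fin; exact: hw.2.
have Lcvg : L (F n) @[n --> \oo] --> L f.
  apply: cvg_integral_nondecreasing => //.
  - move=> n; apply: emeasurable_funM; last exact: measurable_weight.
    apply: (measurableT_comp (measurable_poweR _)).
    by apply: nondecreasing_emeasurable => //; exact: primitive_nd.
  - by move=> n t t0; rewrite mule_ge0 ?poweR_ge0// w0.
  - move=> t t0 m n mn; rewrite lee_wpmul2r ?w0//; apply: lee_poweR (hFnd t _ _ mn) => //.
    exact: ltW.
  - move=> t t0; apply: cvgeZr => //.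
    by apply: poweR_cvg_nondecreasing => //; exact: hFnd.
rewrite -(cvg_lim _ Lcvg)//; apply: lime_le; first by apply/cvg_ex; eexists; exact: Lcvg.
have Fsupp n s : ~ `]0%R, n.+1%:R[%classic s -> F n s = 0%R.
  by move=> ns; rewrite /F patchE; case: ifPn => //; rewrite inE.
apply: nearW => n; apply: (bounded_sufficiency (ltr0Sn R n) (mF n) (F0 n) (Fn n)
  (Fsupp n) hv hw hp hq M0 Vfin Mbound).
apply: le_trans If; apply: ge0_le_integral => //.
- move=> t; rewrite /= in_itv/= andbT => t0.
  by rewrite lee_fin mulr_ge0 ?powR_ge0// hv.2.
- exact: measurable_powRw.
- exact: measurable_powRw.
move=> t; rewrite /= in_itv/= andbT => t0; rewrite lee_fin.
rewrite ler_wpM2r ?hv.2// ge0_ler_powR ?nnegrE ?hf.2 ?Ff//; exact: ltW.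
Unshelve. all: by end_near. Qed.

(** By homogeneity, the normalized bound is applied to [f / c]. Asking only for [I f <= c^p] lets
    [c] tend to 0 when [I f = 0]. The constant [K^(1/q) + 1] is positive even for [K = 0], which
    also settles [I f = +oo]. *)
Lemma hardy_scaling K : (0 <= K)%R ->
  (forall f : R -> R, nonneg_measurable f -> I f <= 1 -> L f <= K%:E) ->
  exists C : R, (0 < C)%R /\ forall f : R -> R, nonneg_measurable f ->
    (L f) `^ q^-1 <= C%:E * (I f) `^ p^-1.
Proof.
move=> K0 HK; pose k := (K `^ q^-1)%R; have k0 : (0 <= k)%R by exact: powR_ge0.
have scaled (c : R) f : (0 < c)%R -> nonneg_measurable f -> I f <= (c `^ p)%:E ->
    (L f) `^ q^-1 <= (k * c)%:E.
  move=> c0 hf If; pose F s := (c^-1 * f s)%R.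
  have f0 s : (0 < s)%R -> (0 <= f s)%R by exact: hf.2.
  have ci0 : (0 <= c^-1)%R by rewrite invr_ge0 ltW.
  have hF : nonneg_measurable F.
    split; last by move=> s s0; rewrite mulr_ge0// f0.
    by apply: measurable_funM => //; exact: hf.1.
  have IF : I F <= 1.
    rewrite (_ : I F = ((c^-1) `^ p)%:E * I f).
      apply: (@le_trans _ _ (((c^-1) `^ p)%:E * (c `^ p)%:E)).
        by rewrite lee_wpmul2l ?lee_fin ?powR_ge0.
      by rewrite -EFinM -powRM ?(ltW c0)// mulVf ?gt_eqF// powR1.
    rewrite -ge0_integralZl//; last 3 first.
    - exact: measurable_powRw.
    - move=> t; rewrite /= in_itv/= andbT => t0.
      by rewrite lee_fin mulr_ge0 ?powR_ge0// hv.2.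
    - by rewrite lee_fin powR_ge0.
    apply: eq_integral => t; rewrite inE/= in_itv/= andbT => t0.
    by rewrite -EFinM /F powRM ?f0// mulrA.
  have hfF t : h F t = (c^-1)%:E * h f t.
    rewrite -ge0_integralZl//; last 2 first.
    - by apply: measurable_weight => //; exact: subset_itvoo.
    - move=> s /subset_itvoo; rewrite /= in_itv/= andbT => s0.
      by rewrite lee_fin f0.
  have hf0 t : 0 <= h f t.
    apply: integral_ge0 => s /subset_itvoo; rewrite /= in_itv/= andbT => s0.
    by rewrite lee_fin f0.
  have LF : L F = ((c^-1) `^ q)%:E * L f.
    rewrite -ge0_integralZl//; last 3 first.
    - apply: emeasurable_funM; last exact: measurable_weight.
      apply: (measurableT_comp (measurable_poweR _)).
      by apply: nondecreasing_emeasurable => //; exact: primitive_nd.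
    - move=> t; rewrite /= in_itv/= andbT => t0.
      by rewrite mule_ge0 ?poweR_ge0// lee_fin hw.2.
    - by rewrite lee_fin powR_ge0.
    by apply: eq_integral => t _; rewrite hfF poweRM ?lee_fin// muleA.
  have L0 : 0 <= L f.
    apply: integral_ge0 => t; rewrite /= in_itv/= andbT => t0.
    by rewrite mule_ge0 ?poweR_ge0// lee_fin hw.2.
  have : (L F) `^ q^-1 <= k%:E.
    apply: (@le_trans _ _ (K%:E `^ q^-1)); last by rewrite poweR_EFin.
    apply: lee_poweR; [by rewrite invr_ge0 ltW| |exact: HK].
    by rewrite LF mule_ge0// lee_fin powR_ge0.
  rewrite LF poweRM ?lee_fin ?powR_ge0// -poweR_EFin poweRK ?lee_fin//.
  by rewrite mulrC EFinM -lee_pdivrMl// muleC.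
exists (k + 1)%R; split; first by rewrite ltr_wpDl.
move=> f hf; have I0 : 0 <= I f.
  apply: integral_ge0 => t; rewrite /= in_itv/= andbT => t0.
  by rewrite lee_fin mulr_ge0 ?powR_ge0// hv.2.
have C0 : (0 < k + 1)%R by rewrite ltr_wpDl.
case E : (I f) I0 => [x| |]// x0; last first.
  by rewrite poweRyr ?invr_neq0 ?gt_eqF// gt0_muley// leey.
rewrite lee_fin le_eqVlt in x0; case/predU1P : x0 => [x0|x0].
  rewrite -x0 poweR0r ?invr_neq0 ?gt_eqF// mule0.
  apply/lee_addgt0Pr => e e0; rewrite add0e.
  apply: (@le_trans _ _ (k * (e / (k + 1)))%:E).
    by apply: scaled => //; rewrite ?divr_gt0// E -x0 lee_fin powR_ge0.
  rewrite lee_fin mulrCA ler_piMr ?(ltW e0)// ler_pdivrMr// mul1r lerDl//.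
apply: (@le_trans _ _ (k * (x `^ p^-1))%:E).
  apply: scaled; rewrite ?powR_gt0// E lee_fin -powRrM mulVf ?gt_eqF//.
  by rewrite powRr1// ltW.
by rewrite poweR_EFin -EFinM lee_fin ler_wpM2r ?powR_ge0// lerDl.
Qed.

End sufficiency.

(** * Necessity *)

Section necessity.
Context {R : realType}.
Local Notation mu := (@lebesgue_measure R).
Variables (v w : R -> R) (p q C : R).
Hypotheses (hv : nonneg_measurable v) (hw : nonneg_measurable w).
Hypotheses (hp : (1 <= p)%R) (hq : (0 < q)%R) (C0 : (0 < C)%R).

Let p0 : (0 < p)%R. Proof. exact: lt_le_trans hp. Qed.

Local Notation h f t := (\int[mu]_(s in `]0%R, t[) (f s)%:E).
Local Notation L f :=
  (\int[mu]_(t in `]0%R, +oo[) ((h f t) `^ q * (w t)%:E)).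
Local Notation I f := (\int[mu]_(t in `]0%R, +oo[) (f t `^ p * v t)%:E).

Hypothesis hardy : forall f : R -> R, nonneg_measurable f ->
  (L f) `^ q^-1 <= C%:E * (I f) `^ p^-1.

Let V0 t : 0 <= hardyV v p t. Proof. exact: hardyV_ge0. Qed.

Let w0 t : `]0%R, +oo[%classic t -> 0 <= (w t)%:E.
Proof. by rewrite /= in_itv/= andbT lee_fin; exact: hw.2. Qed.

Let mhw f (D : set R) : nonneg_measurable f -> measurable D ->
  D `<=` `]0%R, +oo[ -> measurable_fun D (fun t => (h f t) `^ q * (w t)%:E).
Proof.
move=> hf mD D0; apply: emeasurable_funM; last exact: measurable_weight.
apply: (measurableT_comp (measurable_poweR _)).
by apply: nondecreasing_emeasurable => //; exact: primitive_nd.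
Qed.

Let hw0 f t : `]0%R, +oo[%classic t -> 0 <= (h f t) `^ q * (w t)%:E.
Proof. by move=> t0; rewrite mule_ge0 ?poweR_ge0// w0. Qed.

Let L_lower f c t (E : set R) : nonneg_measurable f -> (0 <= t)%R ->
  measurable E -> E `<=` `]t, +oo[ -> 0 <= c -> c <= h f t ->
  c `^ q * \int[mu]_(s in E) (w s)%:E
  <= \int[mu]_(s in E) ((h f s) `^ q * (w s)%:E).
Proof.
move=> hf t0 mE Et c0 ch.
have E0 : E `<=` `]0%R, +oo[ by exact: subset_trans Et (@subset_itvoy _ _ t0).
rewrite -ge0_integralZl//; last 3 first.
- exact: measurable_weight.
- by move=> s /E0; exact: w0.
- exact: poweR_ge0.
apply: ge0_le_integral => //.
- by move=> s /E0 s0; rewrite mule_ge0 ?poweR_ge0// w0.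
- by apply: emeasurable_funM => //; exact: measurable_weight.
- exact: mhw.
move=> s Es; rewrite lee_wpmul2r ?w0//; first exact: E0.
apply: lee_poweR => //; first exact: ltW.
apply: (le_trans ch); apply: primitive_nd => //.
by move: (Et _ Es); rewrite /= in_itv/= andbT => /ltW.
Qed.

(** The test function for [c] at [t] has a primitive of at least [c] on all of []t, oo[]. A real [c]
    below [V(t)] is used because [V(t)] may be infinite. *)
Lemma hardyW_test (c t : R) : (0 < c)%R -> c%:E < hardyV v p t ->
  c%:E * hardyW w t `^ q^-1 <= C%:E.
Proof.
move=> c0 cV; have t0 : (0 <= t)%R.
  rewrite leNgt; apply/negP => t0; move: cV; rewrite hardyV_le0 ?(ltW t0)//.
  by rewrite lte_fin ltNge (ltW c0).
have [f [hf If cf]] := hardyV_test hv hp c0 cV.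
apply: (@le_trans _ _ ((L f) `^ q^-1)); last first.
  apply: (le_trans (hardy hf)); rewrite -[leRHS]mule1 lee_wpmul2l ?lee_fin ?(ltW C0)//.
  rewrite -(poweR1r p^-1); apply: lee_poweR => //; first by rewrite invr_ge0 ltW.
  apply: integral_ge0 => s; rewrite /= in_itv/= andbT => s0.
  by rewrite lee_fin mulr_ge0 ?powR_ge0// hv.2.
have -> : c%:E * hardyW w t `^ q^-1 = (c%:E `^ q * hardyW w t) `^ q^-1.
  by rewrite poweRM ?poweR_ge0 ?hardyW_ge0// poweRK// lee_fin ltW.
apply: lee_poweR; first by rewrite invr_ge0 ltW.
  by rewrite mule_ge0 ?poweR_ge0 ?hardyW_ge0.
apply: le_trans (L_lower hf t0 _ _ _ cf) _ => //; first by rewrite lee_fin ltW.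
apply: ge0_subset_integral => //; first exact: mhw.
  by move=> s; exact: hw0.
exact: subset_itvoy.
Qed.

(* Hoelder's inequality for the constant function 1. *)
Lemma hardyV_gt0 (t : R) : (0 < t)%R -> 0 < hardyV v p t.
Proof.
move=> t0; rewrite lt_def V0 andbT; apply/eqP => Vt.
have hone : nonneg_measurable (cst 1%R : R -> R) by [].
have := @hardyV_hoelder _ v (cst 1%R) p t `]0%R, t[ hv hone hp.
rewrite Vt mul0e => /(_ _ _ _)/wrap[]//.
rewrite -/(cst 1%R) (_ : h (cst 1%R) t = \int[mu]_(s in `]0%R, t[) (cst 1 s))//.
rewrite integral_cst// mul1e [leLHS]lebesgue_measure_itv/= lte_fin t0.
by rewrite -EFinB lee_fin subr0 leNgt t0.
Qed.

(** Since [V(t) > 0], some positive [c] lies below it, and [hardyW_test] applies. At [t = 0] this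
    would be false: for [v = 1], [p = q = 2] and [w(t) = t^(-2)] the inequality holds and
    [W(0) = +oo]. *)
Lemma hardyW_lty (t : R) : (0 < t)%R -> hardyW w t < +oo.
Proof.
move=> t0; rewrite ltey; apply/eqP => Wt.
have [c c0 cV] : exists2 c : R, (0 < c)%R & c%:E < hardyV v p t.
  have := hardyV_gt0 t0; case: (hardyV v p t) => [x| |]//.
    rewrite lte_fin => x0; exists (x / 2)%R; first by rewrite divr_gt0.
    by rewrite lte_fin ltr_pdivrMr// ltr_pMr// ltr1n.
  by move=> _; exists 1%R => //; exact: ltry.
have := hardyW_test c0 cV.
by rewrite Wt poweRyr ?invr_neq0 ?gt_eqF// gt0_muley// leye_eq.
Qed.

Lemma hardyA_le (pq : (p <= q)%R) : hardyA v w p q <= C%:E.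
Proof.
rewrite /hardyA pq; apply: ge_ereal_sup => _ [t /= + <-].
rewrite in_itv/= andbT => t0; rewrite leNgt; apply/negP.
have := hardyW_lty t0; have := hardyW_ge0 hw (ltW t0).
have := @hardyW_test ^~ t.
case: (hardyW w t) => [x| |]// test; rewrite lee_fin => x0 _.
rewrite poweR_EFin in test *; set y := (x `^ q^-1)%R in test *.
have y0 : (0 <= y)%R by exact: powR_ge0.
rewrite le_eqVlt in y0; case/predU1P : y0 => [<-|y0].
  by rewrite mule0 lte_fin ltNge (ltW C0).
rewrite muleC -lte_pdivrMl// -EFinM => CV.
(* Any real [c] strictly between [C / W(t)^(1/q)] and [V(t)] contradicts the test inequality; one
   exists also when [V(t) = +oo]. *)
have [c Cc cV] : exists2 c : R, (y^-1 * C < c)%R & c%:E < hardyV v p t.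
  move: CV; case: (hardyV v p t) => [z| |]//.
    rewrite lte_fin => Cz; exists ((y^-1 * C + z) / 2)%R; first by rewrite midf_lt.
    by rewrite lte_fin midf_lt.
  by move=> _; exists (y^-1 * C + 1)%R; [rewrite ltrDl|exact: ltry].
have c0 : (0 < c)%R by apply: lt_trans Cc; rewrite mulr_gt0// invr_gt0.
have := test c c0 cV; rewrite -EFinM lee_fin leNgt.
by rewrite mulrC -ltr_pdivrMl// Cc.
Qed.

Hypothesis qp : (q < p)%R.

Let b := (p / (p - q))%R.
Let r := (p * q / (p - q))%R.

Let pq0 : (0 < p - q)%R. Proof. by rewrite subr_gt0. Qed.
Let b0 : (0 < b)%R. Proof. by rewrite divr_gt0. Qed.
Let r0 : (0 < r)%R. Proof. by rewrite divr_gt0// mulr_gt0. Qed.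
Let b1 : (1 <= b)%R.
Proof. by rewrite /b ler_pdivlMr// mul1r lerBlDr lerDl ltW. Qed.

(** A nonzero maximum is one of the terms, so its power is one of the summands. A sum of test
    functions in place of their maximum would, for [p > 1], cost a factor growing with their
    number. *)
Lemma powR_bigmax_le (x : R^nat) (u : seq nat) : (forall k, 0 <= x k)%R ->
  ((\big[Num.max/0]_(k <- u) x k) `^ p <= \sum_(k <- u) x k `^ p)%R.
Proof.
move=> x0; suff : [/\ (0 <= \big[Num.max/0]_(k <- u) x k)%R,
    (0 <= \sum_(k <- u) x k `^ p)%R &
    ((\big[Num.max/0]_(k <- u) x k) `^ p <= \sum_(k <- u) x k `^ p)%R] by case.
elim: u => [|k u [m0 s0 ih]].
  by rewrite !big_nil powR0 ?gt_eqF.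
rewrite !big_cons; split.
- by rewrite le_max x0.
- by rewrite addr_ge0// powR_ge0.
- by rewrite /Order.max; case: ifP => _; [rewrite (le_trans ih)// lerDr powR_ge0|rewrite lerDl].
Qed.

Lemma measurable_bigmax (D : set R) (F : nat -> R -> R) (u : seq nat) :
  (forall k, measurable_fun D (F k)) ->
  measurable_fun D (fun s => \big[Num.max/0%R]_(k <- u) F k s).
Proof.
move=> mF; elim: u => [|k u ih].
  by under eq_fun do rewrite big_nil; exact: measurable_cst.
by under eq_fun do rewrite big_cons; exact: measurable_maxr.
Qed.

(* Hardy's inequality is applied to the maximum of the [l_k f_k], [f_k] being
   nearly extremal for [V(t_k)] and [l_k ^ p = c_k ^ r w_k ^ b]. *)
Lemma test_sum (K : nat) (c t : R^nat) (E : (set R)^nat) :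
  (forall k, 0 < c k)%R -> (forall k, (c k)%:E < hardyV v p (t k)) ->
  (forall k, 0 < t k)%R -> (forall k, measurable (E k)) -> trivIset setT E ->
  (forall k, E k `<=` `]t k, +oo[) ->
  \sum_(k < K) (c k `^ r)%:E * (\int[mu]_(s in E k) (w s)%:E) `^ b
  <= (C `^ r)%:E.
Proof.
move=> c0 cV t0 mE tE Et.
have E0 k : E k `<=` `]0%R, +oo[.
  by apply: subset_trans (Et k) (subset_itvoy _); exact: ltW.
have Wfin k : \int[mu]_(s in E k) (w s)%:E \is a fin_num.
  rewrite ge0_fin_numE; last by apply: integral_ge0 => s /E0; exact: w0.
  apply: le_lt_trans (hardyW_lty (t0 k)); apply: integral_le_hardyW => //.
  exact: ltW.
pose o k := fine (\int[mu]_(s in E k) (w s)%:E).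
have oE k : \int[mu]_(s in E k) (w s)%:E = (o k)%:E by rewrite fineK.
have o0 k : (0 <= o k)%R by rewrite fine_ge0// integral_ge0// => s /E0; exact: w0.
have /choice[f ftest] := fun k => hardyV_test hv hp (c0 k) (cV k).
have hf k : nonneg_measurable (f k) by have [] := ftest k.
have If k : I (f k) <= 1 by have [] := ftest k.
have cf k : (c k)%:E <= h (f k) (t k) by have [] := ftest k.
pose e k := (c k `^ r * o k `^ b)%R.
have e0 k : (0 <= e k)%R by rewrite mulr_ge0 ?powR_ge0.
pose l k := (e k `^ p^-1)%R.
have l0 k : (0 <= l k)%R by exact: powR_ge0.
have lp k : (l k `^ p = e k)%R by rewrite -powRrM mulVf ?gt_eqF// powRr1.
pose S := (\sum_(k < K) e k)%R.
have S0 : (0 <= S)%R by apply: sumr_ge0.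
have SE : \sum_(k < K) (c k `^ r)%:E * (\int[mu]_(s in E k) (w s)%:E) `^ b = S%:E.
  by rewrite /S -sumEFin; apply: eq_bigr => k _; rewrite oE poweR_EFin -EFinM.
rewrite SE.
have lf0 k s : (0 < s)%R -> (0 <= l k * f k s)%R.
  by move=> s0; rewrite mulr_ge0// (hf k).2.
pose F s := \big[Num.max/0%R]_(0 <= k < K) (l k * f k s)%R.
have hF : nonneg_measurable F.
  split; last first.
    move=> s s0; rewrite /F; elim/big_ind : _ => [//|x y x0 _|k _]; last exact: lf0.
    by rewrite le_max x0.
  apply: measurable_bigmax => k; apply: measurable_funM => //.
  exact: (hf k).1.
have IF : I F <= S%:E.
  have fv0 k s : `]0%R, +oo[%classic s -> 0 <= (f k s `^ p * v s)%:E.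
    rewrite /= in_itv/= andbT => s0.
    by rewrite lee_fin mulr_ge0 ?powR_ge0// hv.2.
  have mfv k : measurable_fun (`]0%R, +oo[ : set R) (fun s => (f k s `^ p * v s)%:E).
    exact: measurable_powRw.
  apply: (@le_trans _ _ (\int[mu]_(s in `]0%R, +oo[)
      \sum_(k < K) ((e k)%:E * (f k s `^ p * v s)%:E))).
    apply: ge0_le_integral => //.
    - move=> s; rewrite /= in_itv/= andbT => s0.
      by rewrite lee_fin mulr_ge0 ?powR_ge0// hv.2.
    - exact: measurable_powRw.
    - by apply: emeasurable_sum => k; apply: emeasurable_funM; [exact: measurable_cst|exact: mfv].
    move=> s; rewrite /= in_itv/= andbT => s0.
    under eq_bigr do rewrite -EFinM mulrA.
    rewrite sumEFin lee_fin -mulr_suml ler_wpM2r ?hv.2//.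
    apply: (le_trans (powR_bigmax_le _ (fun k => lf0 k s s0))).
    rewrite big_mkord le_eqVlt; apply/orP; left; apply/eqP; apply: eq_bigr => k _.
    by rewrite powRM ?(hf k).2// lp.
  rewrite ge0_integral_sum//; last 2 first.
  - by move=> k; apply: emeasurable_funM; [exact: measurable_cst|exact: mfv].
  - by move=> k s s0; rewrite mule_ge0 ?lee_fin// -lee_fin fv0.
  rewrite /S -sumEFin; apply: lee_sum => k _.
  rewrite ge0_integralZl//; last 3 first.
  - exact: mfv.
  - by move=> s; exact: fv0.
  - by rewrite lee_fin.
  by rewrite -[leRHS]mule1 lee_wpmul2l// lee_fin.
have hFk k : (k < K)%N -> (l k * c k)%:E <= h F (t k).
  move=> kK; apply: (@le_trans _ _ (\int[mu]_(s in `]0%R, t k[) ((l k)%:E * (f k s)%:E))).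
    rewrite ge0_integralZl//; last 3 first.
    - by apply: measurable_weight => //; exact: subset_itvoo.
    - by move=> s /subset_itvoo; rewrite /= in_itv/= andbT lee_fin => /(hf k).2.
    - by rewrite lee_fin.
    by rewrite EFinM lee_wpmul2l// lee_fin.
  apply: ge0_le_integral => //.
  - move=> s /subset_itvoo; rewrite /= in_itv/= andbT => s0.
    by rewrite -EFinM lee_fin lf0.
  - apply: emeasurable_funM => //.
    by apply: measurable_weight => //; exact: subset_itvoo.
  - by apply: measurable_weight => //; exact: subset_itvoo.
  move=> s _; rewrite -EFinM lee_fin /F.
  by apply: (@le_bigmax_seq _ _ _ _ _ k xpredT (fun k => l k * f k s)%R); rewrite ?mem_index_iota.
have SL : S%:E <= L F.
  apply: (@le_trans _ _ (\sum_(k < K) \int[mu]_(s in E k) ((h F s) `^ q * (w s)%:E))).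
    rewrite /S -sumEFin; apply: lee_sum => k _.
    apply: le_trans (L_lower hF (ltW (t0 k)) (mE k) (Et k) _ (hFk k (ltn_ord k))); last first.
      by rewrite lee_fin mulr_ge0// ltW.
    rewrite oE poweR_EFin -EFinM lee_fin powRM ?(ltW (c0 k))//.
    rewrite le_eqVlt; apply/orP; left; apply/eqP.
    rewrite /l -powRrM /e powRM ?powR_ge0// -!powRrM.
    (* The multipliers reproduce the sum exactly: [l^q c^q o = e], because [b q / p = b - 1] and
       [r q / p + q = r]. *)
    have -> : (b * (p^-1 * q) = b - 1)%R.
      by rewrite /b; field; rewrite !gt_eqF.
    have acom (x y z u : R) : (x * y * z * u = (x * z) * (u * y))%R by ring.
    rewrite acom mulr_powRB1// -powRD ?(gt_eqF (c0 k)) ?implybT//.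
    by congr (_ `^ _ * _)%R; rewrite /r; field; rewrite !gt_eqF.
  rewrite -(big_mkord xpredT (fun k => \int[mu]_(s in E k) ((h F s) `^ q * (w s)%:E))).
  apply: (le_trans (nneseries_lim_ge _ _)).
    by move=> k _ _; apply: integral_ge0 => s /E0; exact: hw0.
  rewrite -ge0_integral_bigcup//.
  - apply: ge0_subset_integral => //.
    + exact: bigcupT_measurable.
    + exact: mhw.
    + by move=> s; exact: hw0.
    + by move=> s [k _]; exact: E0.
  - apply: mhw => //; first exact: bigcupT_measurable.
    by move=> s [k _]; exact: E0.
  - by move=> s [k _] /E0; exact: hw0.
rewrite le_eqVlt in S0; case/predU1P : S0 => [<-|S0].
  by rewrite lee_fin powR_ge0.
(* [S] is a positive real, so [S^(1/p)] can be cancelled, leaving [S^(1/q - 1/p) <= C] with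
   [1/q - 1/p = 1/r]. *)
have : (S `^ q^-1)%:E <= (C * S `^ p^-1)%:E.
  rewrite -poweR_EFin; apply: (@le_trans _ _ ((L F) `^ q^-1)).
    by apply: lee_poweR => //; rewrite ?lee_fin ?invr_ge0 ltW.
  apply: (le_trans (hardy hF)); rewrite EFinM lee_wpmul2l ?lee_fin ?(ltW C0)//.
  rewrite -poweR_EFin; apply: lee_poweR => //; first by rewrite invr_ge0 ltW.
  apply: integral_ge0 => s; rewrite /= in_itv/= andbT => s0.
  by rewrite lee_fin mulr_ge0 ?powR_ge0// hv.2.
rewrite !lee_fin -ler_pdivrMr ?powR_gt0// -powRB ?(gt_eqF S0) ?implybT// => SC.
have -> : S = ((S `^ (q^-1 - p^-1)) `^ r)%R.
  rewrite -powRrM (_ : (q^-1 - p^-1) * r = 1)%R ?powRr1 ?ltW//.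
  by rewrite /r; field; rewrite !gt_eqF.
by apply: ge0_ler_powR => //; rewrite ?nnegrE ?powR_ge0// ltW.
Qed.

End necessity.

(** * Cutting a Stieltjes integral at geometric levels *)

Section levels.
Context {R : realType}.

Lemma integral_le_cst d (T : measurableType d) (nu : {measure set T -> \bar R})
    (D : set T) (F : T -> \bar R) (M : \bar R) (y : R) :
  measurable D -> measurable_fun D F -> (forall x, D x -> 0 <= F x) ->
  0 <= M -> (forall x, D x -> F x <= M) -> nu D <= y%:E ->
  \int[nu]_(x in D) F x <= y%:E * M.
Proof.
move=> mD mF F0 M0 FM Dy.
apply: (@le_trans _ _ (\int[nu]_(x in D) (cst M x))).
  by apply: ge0_le_integral.
by rewrite integral_cst// muleC lee_wpmul2r.
Qed.

(* The level points [x_k] of the truncated [g], for the levels [Y B ^- (k+1)],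
   lie below its supremum [Y]; they exist since the first level is below [Y]. *)
Lemma ls_integral_levels (g : R -> \bar R) (n : nat) (F : R -> \bar R) (B : R) :
  (forall t, 0 <= g t) -> {homo g : x y / (x <= y)%R >-> x <= y} ->
  (forall t : R, (t <= 0)%R -> g t = 0) ->
  measurable_fun (`[0%R, +oo[ : set R) F ->
  (forall t, (0 <= t)%R -> 0 <= F t) ->
  (forall s t, (0 <= s)%R -> (s <= t)%R -> F t <= F s) -> (1 < B)%R ->
  let X := \int[lebesgue_stieltjes_measure (ls_trunc g n)]_(t in `[0%R, +oo[) F t in
  X = 0 \/ exists Y (x : R^nat), [/\ (0 < Y)%R, (forall k, 0 <= x k)%R,
    (forall k, x k.+1 <= x k)%R,
    (forall k e, (0 < e)%R -> (Y / B ^+ k.+1)%:E <= g (x k + e)%R) &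
    forall K, X <= \sum_(k < K.+1) (Y / B ^+ k)%:E * F (x k) +
      (Y / B ^+ K.+1)%:E * F 0%R].
Proof.
move=> g0 gnd gneg mF F0 Fni B1 X.
have B0 : (0 < B)%R by exact: lt_trans B1.
pose tau := ls_trunc g n; pose Y := sup (range tau).
have tau0 t : (0 <= tau t)%R by exact: ls_trunc_ge0.
have taun t : (tau t <= n%:R)%R by exact: ls_trunc_le_nat.
have tau_neg t : (t < 0)%R -> tau t = 0%R by exact: ls_trunc_lt0.
have supY : has_sup (range tau).
  split; first by exists (tau 0%R), 0%R.
  by exists n%:R => _ [t _ <-].
have tauY t : (tau t <= Y)%R by apply: sup_upper_bound => //; exists t.
have mI (i : interval R) : measurable ([set` i] : set (measurableTypeR R)).
  exact: measurable_itv.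
have mFi (i : interval R) : [set` i] `<=` (`[0%R, +oo[ : set R) ->
    measurable_fun ([set` i] : set (measurableTypeR R)) F.
  by move=> si; exact: (@measurable_funS _ _ _ _ _ _ _ _ si mF).
have le_itv (i : interval R) (a y : R) : (0 <= a)%R ->
    [set` i] `<=` (`[a, +oo[ : set R) ->
    lebesgue_stieltjes_measure (ls_trunc g n) [set` i] <= y%:E ->
    \int[lebesgue_stieltjes_measure (ls_trunc g n)]_(t in [set` i]) F t
    <= y%:E * F a.
  move=> a0 ia iy; have i0 : [set` i] `<=` (`[0%R, +oo[ : set R).
    apply: subset_trans ia _ => t /=; rewrite !in_itv/= !andbT.
    exact: le_trans.
  apply: integral_le_cst => //.
  - exact: mFi.
  - by move=> t /i0 /=; rewrite in_itv/= andbT; exact: F0.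
  - exact: F0.
  - by move=> t /ia /=; rewrite in_itv/= andbT; exact: Fni.
have N10 : (-1 < 0 :> R)%R by rewrite ltrN10.
(* A closed left endpoint may carry an atom; the intervals are therefore enlarged to start at [-1],
   open, where the earlier measure bounds apply. *)
have muS (i j : interval R) (y : R) : [set` i] `<=` [set` j] ->
    lebesgue_stieltjes_measure (ls_trunc g n) [set` j] <= y%:E ->
    lebesgue_stieltjes_measure (ls_trunc g n) [set` i] <= y%:E.
  by move=> ij; apply: le_trans; apply: le_measure; rewrite ?inE//; exact: mI.
have muy (a : R) : (0 <= a)%R ->
    lebesgue_stieltjes_measure (ls_trunc g n) `[a, +oo[ <= Y%:E.
  move=> a0; apply: (@muS _ `](-1)%R, +oo[).
    by move=> t /=; rewrite !in_itv/= !andbT; apply: lt_le_trans; exact: lt_le_trans a0.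
  exact: lebesgue_stieltjes_itvoy_le.
have muo (a x y : R) : (0 <= a)%R -> (forall t, t < x -> tau t <= y)%R ->
    lebesgue_stieltjes_measure (ls_trunc g n) `[a, x[ <= y%:E.
  move=> a0 xy; apply: (@muS _ `](-1)%R, x[).
    move=> t /=; rewrite !in_itv/= => /andP[at_ ->]; rewrite andbT.
    by apply: lt_le_trans at_; exact: lt_le_trans a0.
  exact: lebesgue_stieltjes_itvoo_le.
have Y0 : (0 <= Y)%R by exact: le_trans (tauY 0%R).
rewrite le_eqVlt in Y0; case/predU1P : Y0 => [Y0|Y0]; [left|right].
  apply/eqP; rewrite eq_le; apply/andP; split.
    have := @le_itv `[0%R, +oo[ 0%R 0%R (lexx _) (@subset_refl _ _).
    by rewrite mul0e; apply; rewrite {2}Y0; exact: muy.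
  by apply: integral_ge0 => t /=; rewrite in_itv/= andbT; exact: F0.
pose y k := (Y / B ^+ k.+1)%R.
have yY k : (Y / B ^+ k = B * y k)%R.
  by rewrite /y exprS invfM mulrCA (mulrA B) divff ?mul1r// gt_eqF.
have y0 k : (0 < y k)%R by rewrite divr_gt0// exprn_gt0.
have yS k : (y k.+1 <= y k)%R.
  rewrite -[leRHS]/(Y / B ^+ k.+1)%R yY ler_peMl ?(ltW (y0 _))//.
  exact: ltW.
pose S k := [set t | 0 <= t /\ y k <= tau t]%R.
have infS k : has_inf (S k).
  split; last by exists 0%R => t [].
  have yYk : (y k < Y)%R by rewrite ltr_pdivrMr ?exprn_gt0// ltr_pMr// exprn_egt1.
  have Yy0 : (0 < Y - y k)%R by rewrite subr_gt0.
  have [_ [t _ <-]] := sup_adherent Yy0 supY; rewrite subKr => yt.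
  exists t; split; last exact: ltW.
  rewrite leNgt; apply/negP => /tau_neg t0.
  by have := lt_trans (y0 k) yt; rewrite t0 ltxx.
pose x k := inf (S k).
have x0 k : (0 <= x k)%R by apply: lb_le_inf; [exact: (infS k).1|move=> t []].
have xS k : (x k.+1 <= x k)%R.
  apply: lb_le_inf; first exact: (infS k).1.
  move=> t [t0 yt]; apply: ge_inf; first exact: (infS k.+1).2.
  by split => //; exact: le_trans (yS k) yt.
have tau_lt k t : (t < x k)%R -> (tau t <= y k)%R.
  move=> tx; have [t0|t0] := ltP t 0%R; first by rewrite tau_neg// ltW.
  rewrite leNgt; apply/negP => yt; move: tx; rewrite ltNge => /negP; apply.
  by apply: ge_inf; [exact: (infS k).2|split => //; exact: ltW].
exists Y, x; split => //.
(* The level is reached at some [t < x k + e], and the strict inequality lets [g (x k + e)] dominate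
   the right limit at [t]. *)
- move=> k e e0; have [t [t0 yt] tx] := inf_adherent e0 (infS k).
  apply: (@le_trans _ _ (tau t)%:E); first by rewrite lee_fin.
  by apply: (le_trans (ls_trunc_le g0 n tx)); rewrite ge_min lexx.
(* Each piece [[x (K + 1), x K[] is charged the bound [Y / B ^ (K + 1)] for all the mass in [[0, x
   K[]; geometric levels make this affordable. The remainder [[0, x K[] gets the same bound and
   produces the term with [F 0]. *)
move=> K; have tail : \int[lebesgue_stieltjes_measure (ls_trunc g n)]_(t in `[x K, +oo[) F t
    <= \sum_(k < K.+1) (Y / B ^+ k)%:E * F (x k).
  elim: K => [|K ih].
    rewrite big_ord1 expr0 divr1; apply: le_itv => //.
    exact: muy.
  rewrite big_ord_recr/=.
  have split_itv : `[x K.+1, +oo[%classic =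
      `[x K.+1, x K[ `|` `[x K, +oo[ :> set R.
    apply/seteqP; split => t /=; rewrite !in_itv/= !andbT.
      by move=> ->; have [tx|tx] := ltP t (x K); [left|right].
    by move=> [/andP[]//|]; exact: le_trans (xS K).
  rewrite split_itv ge0_integral_setU//; first last.
  - apply/disj_setPS => t [] /=; rewrite !in_itv/= andbT => /andP[_ tx] xt.
    by have := lt_le_trans tx xt; rewrite ltxx.
  - move=> t; rewrite -split_itv/= in_itv/= andbT => xt.
    by apply: F0; exact: le_trans xt.
  - rewrite -split_itv; apply: mFi => t /=; rewrite !in_itv/= !andbT.
    exact: le_trans.
  rewrite addeC; apply: leeD => //; apply: le_itv => //.
    by move=> t /=; rewrite !in_itv/= andbT => /andP[].
  by apply: muo => //; exact: tau_lt.
have split_itv : `[0%R, +oo[%classic = `[x K, +oo[ `|` `[0%R, x K[ :> set R.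
  apply/seteqP; split => t /=; rewrite !in_itv/= !andbT.
    by move=> ->; have [tx|tx] := ltP t (x K); [right|left].
  by move=> [|/andP[]//]; exact: le_trans.
rewrite /X split_itv ge0_integral_setU//; first last.
- apply/disj_setPS => t [] /=; rewrite !in_itv/= andbT => xt /andP[_ tx].
  by have := lt_le_trans tx xt; rewrite ltxx.
- by move=> t; rewrite -split_itv/= in_itv/= andbT; exact: F0.
- by rewrite -split_itv; exact: mFi.
apply: leeD => //; apply: le_itv => //.
  by move=> t /=; rewrite !in_itv/= andbT => /andP[].
by apply: muo => //; exact: tau_lt.
Qed.

End levels.

(** * Necessity for [q < p]: from blocks back to tails *)

Section conclusion.
Context {R : realType}.

(* The tails [W_k] of the series of the [o_k] are absorbed by the geometric
   weights: [2 * 2 ^ b * y_(k+1) <= 4 ^ b * y_(k+1) = y_k]. *)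
Lemma tail_sum_le (b : R) (y : R^nat) (W o : (\bar R)^nat) :
  (1 <= b)%R -> (forall k, 0 <= y k)%R -> (forall k, y k = 4 `^ b * y k.+1)%R ->
  (forall k, 0 <= W k) -> (forall k, 0 <= o k) ->
  W 0%N <= o 0%N -> (forall k, W k.+1 <= o k.+1 + W k) ->
  forall K, \sum_(k < K.+1) (y k)%:E * W k `^ b + (y K)%:E * W K `^ b
    <= (2 * 2 `^ b)%:E * \sum_(k < K.+1) (y k)%:E * o k `^ b.
Proof.
move=> b1 y0 yS W0 o0 Wo WS; have b0 : (0 <= b)%R by exact: le_trans b1.
have c2 : (2 <= 2 `^ b :> R)%R by rewrite le1r_powR// ler1n.
have c4 : (4 `^ b = 2 `^ b * 2 `^ b :> R)%R.
  by rewrite -powRM//; congr (_ `^ _)%R; ring.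
have yo0 k : 0 <= (y k)%:E * o k `^ b by rewrite mule_ge0 ?lee_fin ?poweR_ge0.
have yW0 k : 0 <= (y k)%:E * W k `^ b by rewrite mule_ge0 ?lee_fin ?poweR_ge0.
elim=> [|K ih].
  rewrite !big_ord1 -mule2n -mule_natl muleC (muleC (2 * _)%:E).
  apply: lee_pmul => //.
    by rewrite lee_wpmul2l ?lee_fin// lee_poweR.
  by rewrite lee_fin ler_peMr// (le_trans _ c2)// ler1n.
(* The last term is carried twice so that the induction closes: the spare copy at [K] pays for the
   tail [W K] that appears when [W (K + 1)] is split. *)
have step : 2%:E * ((y K.+1)%:E * W K.+1 `^ b) <=
    (2 * 2 `^ b)%:E * ((y K.+1)%:E * o K.+1 `^ b) + (y K)%:E * W K `^ b.
  apply: (@le_trans _ _ (2%:E * ((y K.+1)%:E *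
      ((2 `^ b)%:E * (o K.+1 `^ b + W K `^ b))))).
    rewrite lee_wpmul2l// lee_wpmul2l ?lee_fin//.
    apply: (@le_trans _ _ ((o K.+1 + W K) `^ b)).
      exact: lee_poweR.
    exact: poweR_subadd2.
  rewrite !muleA -!EFinM ge0_muleDr ?poweR_ge0//.
  rewrite (_ : (2 * y K.+1 * 2 `^ b = 2 * 2 `^ b * y K.+1)%R); last by ring.
  apply: leeD => //; rewrite lee_wpmul2r ?poweR_ge0// lee_fin (yS K) c4.
  by rewrite ler_wpM2r// ler_wpM2r ?powR_ge0.
rewrite big_ord_recr/= -addeA -mule2n -mule_natl.
apply: (le_trans (leeD2l _ step)); rewrite addeCA.
rewrite [in leRHS]big_ord_recr/= ge0_muleDr ?sume_ge0// [leRHS]addeC.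
exact: leeD2l.
Qed.

Variables (v w : R -> R) (p q C : R).
Hypotheses (hv : nonneg_measurable v) (hw : nonneg_measurable w).
Hypotheses (hp : (1 <= p)%R) (hq : (0 < q)%R) (C0 : (0 < C)%R) (qp : (q < p)%R).
Hypothesis hardy : forall f : R -> R, nonneg_measurable f ->
  (\int[lebesgue_measure]_(t in `]0%R, +oo[)
    ((\int[lebesgue_measure]_(s in `]0%R, t[) (f s)%:E) `^ q * (w t)%:E)) `^ q^-1
  <= C%:E *
  (\int[lebesgue_measure]_(t in `]0%R, +oo[) ((f t `^ p) * v t)%:E) `^ p^-1.

Let b := (p / (p - q))%R.
Let r := (p * q / (p - q))%R.
Let B := (4 `^ b)%R.
(** The outer [B] comes from [Y / B ^ k = B y_k], the factor [2 * 2 ^ b] from [tail_sum_le], the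
    inner [B] from lowering [y_k] to [y_(k+1) = c_k ^ r], and [C ^ r] from [test_sum]. *)
Let M := (B * (2 * 2 `^ b * (B * C `^ r)))%R.

Let p0 : (0 < p)%R. Proof. exact: lt_le_trans hp. Qed.
Let pq0 : (0 < p - q)%R. Proof. by rewrite subr_gt0. Qed.
Let b0 : (0 < b)%R. Proof. by rewrite divr_gt0. Qed.
Let r0 : (0 < r)%R. Proof. by rewrite divr_gt0// mulr_gt0. Qed.
Let b1 : (1 <= b)%R.
Proof. by rewrite /b ler_pdivlMr// mul1r lerBlDr lerDl ltW. Qed.

Let g t := hardyV v p t `^ r.

Let B2 : (2 <= B)%R.
Proof. by apply: (@le_trans _ _ 4%R); [rewrite ler_nat|rewrite le1r_powR// ler1n]. Qed.

Let B0 : (0 < B)%R. Proof. exact: lt_le_trans B2. Qed.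

Let gnd : {homo g : x y / (x <= y)%R >-> x <= y}.
Proof. exact: hardyV_powR_nd. Qed.

Let gneg (t : R) : (t <= 0)%R -> g t = 0.
Proof. exact: hardyV_powR_neg. Qed.

Let mWe (e : R) : (0 <= e)%R ->
  measurable_fun (`[0%R, +oo[ : set R) (fun t => hardyW w (t + e) `^ b).
Proof.
move=> e0; apply: (measurableT_comp (measurable_poweR _)).
exact: measurable_hardyW.
Qed.

(** The shift places the cuts at [x_k + e], where [V^r] is known to reach its level, and makes the
    integrand at 0 finite, so that the error term of the level decomposition tends to 0. *)
Lemma shifted_integral_le (n : nat) (e : R) : (0 < e)%R ->
  \int[lebesgue_stieltjes_measure (ls_trunc g n)]_(t in `[0%R, +oo[)
    (hardyW w (t + e) `^ b) <= M%:E.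
Proof.
move=> e0; have M0 : (0 <= M)%R.
  by rewrite !mulr_ge0 ?powR_ge0// ltW.
have [|||->|] := @ls_integral_levels R g n (fun t => hardyW w (t + e) `^ b) B
    (fun t => poweR_ge0 _ _) gnd gneg (mWe (ltW e0)).
- by move=> t _; exact: poweR_ge0.
- move=> s t s0 st; have t0 := le_trans s0 st; apply: lee_poweR; first exact: ltW.
    by apply: hardyW_ge0 => //; exact: addr_ge0 t0 (ltW e0).
  by apply: hardyW_ni; [exact: hw|exact: addr_ge0 s0 (ltW e0)|rewrite lerD2r].
- by rewrite (lt_le_trans _ B2)// ltr1n.
- by rewrite lee_fin.
move=> [Y [x [Y0 x0 xS xg Xle]]].
pose y k := (Y / B ^+ k.+1)%R.
have yB k : (Y / B ^+ k = B * y k)%R.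
  by rewrite /y exprS invfM mulrCA (mulrA B) divff ?mul1r// gt_eqF.
have y0 k : (0 < y k)%R by rewrite divr_gt0// exprn_gt0.
have yS k : (y k = B * y k.+1)%R by rewrite -yB.
pose t k := (x k + e)%R.
have t0 k : (0 < t k)%R by rewrite ltr_wpDl.
have tdec i j : (i <= j)%N -> (t j <= t i)%R.
  move=> /subnK <-; elim: (j - i)%N => [//|d]; apply: le_trans.
  by rewrite lerD2r addSn.
pose E k : set R := if k is k'.+1 then `]t k, t k']%classic else `]t 0%N, +oo[%classic.
have mE k : measurable (E k) by case: k => [|k]; exact: measurable_itv.
have Et k : E k `<=` `]t k, +oo[.
  by case: k => // k s; rewrite /= !in_itv/= andbT => /andP[].
have tE : trivIset setT E.
  apply/trivIsetP => i j _ _; wlog ij : i j / (i < j)%N.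
    move=> wl; rewrite neq_ltn => /orP[ij|ji]; first by apply: wl => //; rewrite ltn_eqF.
    by rewrite setIC; apply: wl => //; rewrite ltn_eqF.
  move=> _; apply/seteqP; split => // s [/Et]; case: j ij => // j ij.
  rewrite /= !in_itv/= andbT => ts /andP[_ st].
  by have := lt_le_trans ts (le_trans st (tdec i j ij)); rewrite ltxx.
(* Going one level down makes [c k] strictly smaller than [V(t_k)], as [test_sum] requires. *)
pose c k := (y k.+1 `^ r^-1)%R.
have c0 k : (0 < c k)%R by rewrite powR_gt0.
have cr k : (c k `^ r = y k.+1)%R by rewrite -powRrM mulVf ?gt_eqF// powRr1// ltW.
have cV k : (c k)%:E < hardyV v p (t k).
  rewrite ltNge; apply/negP => Vc; have : g (t k) <= (y k.+1)%:E.
    by rewrite -cr -poweR_EFin; apply: lee_poweR (ltW r0) (hardyV_ge0 _ _ _) Vc.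
  move/(le_trans (xg k e e0)); rewrite lee_fin -/(y k) yS leNgt.
  by rewrite ltr_pMl// (lt_le_trans _ B2)// ltr1n.
pose o k := \int[lebesgue_measure]_(s in E k) (w s)%:E.
have o0 k : 0 <= o k.
  apply: integral_ge0 => s /Et; rewrite /= in_itv/= andbT => ts.
  by rewrite lee_fin hw.2// (lt_trans _ ts).
have osum K : \sum_(k < K) (y k)%:E * o k `^ b <= (B * C `^ r)%:E.
  under eq_bigr do rewrite yS -cr EFinM -muleA.
  rewrite -ge0_sume_distrr; last first.
    by move=> k _; rewrite mule_ge0 ?poweR_ge0// lee_fin powR_ge0.
  rewrite EFinM lee_wpmul2l ?lee_fin ?(ltW B0)//.
  exact: (@test_sum _ v w p q C hv hw hp hq C0 hardy qp K c t E).
have WS k : hardyW w (t k.+1) <= o k.+1 + hardyW w (t k).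
  rewrite /hardyW /o/= -ge0_integral_setU//.
  - rewrite le_eqVlt; apply/orP; left; apply/eqP; congr (integral _ _ _).
    apply/seteqP; split => s /=; rewrite !in_itv/= !andbT.
      by move=> ->; have [st|ts] := leP s (t k); [left|right].
    by move=> [/andP[]//|]; apply: le_lt_trans; exact: tdec.
  - apply: measurable_weight => //; first exact: measurableU.
    move=> s /=; rewrite !in_itv/= !andbT => -[/andP[ts _]|ts];
    exact: lt_trans ts.
  - move=> s /=; rewrite !in_itv/= !andbT => ts; rewrite lee_fin hw.2//.
    by case: ts => [/andP[ts _]|ts]; exact: lt_trans ts.
  - apply/disj_setPS => s [] /=; rewrite !in_itv/= andbT => /andP[_ st] ts.
    by have := le_lt_trans st ts; rewrite ltxx.
have tail K : \sum_(k < K.+1) (Y / B ^+ k)%:E * hardyW w (x k + e) `^ b <= M%:E.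
  under eq_bigr do rewrite yB EFinM -muleA.
  rewrite -ge0_sume_distrr; last first.
    by move=> k _; rewrite mule_ge0 ?poweR_ge0// lee_fin ltW.
  rewrite EFinM lee_wpmul2l ?lee_fin ?(ltW B0)//.
  have := @tail_sum_le b y (fun k => hardyW w (t k)) o b1 (fun k => ltW (y0 k)) yS
    (fun k => hardyW_ge0 hw (ltW (t0 k))) o0 (lexx _) WS K.
  move=> /(le_trans _) h; apply: (le_trans (h _ _)).
    by rewrite leeDl// mule_ge0 ?poweR_ge0// lee_fin ltW.
  by rewrite [leRHS]EFinM lee_wpmul2l// lee_fin mulr_ge0 ?powR_ge0.
have We : hardyW w (0 + e) `^ b \is a fin_num.
  rewrite add0r ge0_fin_numE ?poweR_ge0// poweR_lty//.
  exact: (@hardyW_lty _ v w p q C hv hw hp hq C0 hardy).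
apply/lee_addgt0Pr => d d0.
pose a := fine (hardyW w (0 + e) `^ b).
have a0 : (0 <= a)%R by rewrite fine_ge0// poweR_ge0.
(* Since [B >= 2] and [2^n > n], the error [a Y / B^(K+1)] falls below any [d > 0]. *)
have [K Kd] : exists K, (Y / B ^+ K.+1 * a <= d)%R.
  exists (Num.truncn (Y * a / d)); rewrite mulrAC ler_pdivrMr ?exprn_gt0//.
  rewrite [leRHS]mulrC -ler_pdivrMr//; apply: (le_trans (ltW (Num.Theory.truncnS_gt _))).
  apply: (@le_trans _ _ (2 ^+ (Num.truncn (Y * a / d)).+1)%R).
    by rewrite -natrX ler_nat ltnW// ltn_expl.
  by rewrite lerXn2r ?nnegrE// ltW.
apply: (le_trans (Xle K)); apply: leeD; first exact: tail.
by rewrite -(fineK We) -EFinM lee_fin.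
Qed.

(** The bound [M] depends neither on the shift nor on the truncation. Letting the shift [1/(k+1)]
    tend to 0, right-continuity of [W] and monotone convergence give the integral for each [n], and
    then the supremum over [n]. *)
Lemma hardyA_le_stieltjes : hardyA v w p q <= M%:E.
Proof.
rewrite /hardyA (leNgt p q) qp/=; apply: ge_ereal_sup => _ [n _ <-].
have cvgX : \int[lebesgue_stieltjes_measure (ls_trunc g n)]_(t in `[0%R, +oo[)
    (hardyW w (t + k.+1%:R^-1) `^ b) @[k --> \oo] -->
    \int[lebesgue_stieltjes_measure (ls_trunc g n)]_(t in `[0%R, +oo[)
    (hardyW w t `^ b).
  have tk (t : R) (k : nat) : (0 <= t)%R -> (0 <= t + k.+1%:R^-1)%R.
    by move=> t0; rewrite addr_ge0.
  have Wnd (t : R) : (0 <= t)%R ->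
      nondecreasing_seq (fun k => hardyW w (t + k.+1%:R^-1)).
    move=> t0 i j ij; apply: hardyW_ni => //; first exact: tk.
    by rewrite lerD2l lef_pV2 ?posrE// ler_nat ltnS.
  apply: cvg_integral_nondecreasing.
  - exact: measurable_itv.
  - by move=> k; apply: mWe.
  - by move=> k t _; exact: poweR_ge0.
  - move=> t /=; rewrite in_itv/= andbT => t0 i j ij.
    apply: lee_poweR (ltW b0) _ (Wnd t t0 i j ij).
    by apply: hardyW_ge0 => //; exact: tk.
  - move=> t /=; rewrite in_itv/= andbT => t0.
    apply: poweR_cvg_nondecreasing => //.
    + by move=> k; apply: hardyW_ge0 => //; exact: tk.
    + exact: Wnd.
    + exact: hardyW_cvg.
rewrite -(cvg_lim _ cvgX)//; apply: lime_le; first by apply/cvg_ex; eexists; exact: cvgX.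
by apply: nearW => k; apply: shifted_integral_le; rewrite invr_gt0.
Qed.

End conclusion.

Theorem theorem2p1 (R : realType) (v w : R -> R) (p q : R)
    (hv : nonneg_measurable v) (hw : nonneg_measurable w)
    (hp : (1 <= p)%R) (hq : (0 < q)%R) :
  (exists C : R, (0 < C)%R /\
    forall f : R -> R, nonneg_measurable f ->
      (\int[lebesgue_measure]_(t in `]0%R, +oo[)
          ((\int[lebesgue_measure]_(s in `]0%R, t[) (f s)%:E) `^ q * (w t)%:E))
        `^ (q^-1)
      <= C%:E *
        (\int[lebesgue_measure]_(t in `]0%R, +oo[)
            ((f t `^ p)%R * v t)%:E) `^ (p^-1))
  <-> hardyA v w p q < +oo.
Proof.
split=> [[C [C0 hardy]]|Aoo].
  have [pq|qp] := leP p q.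
    by apply: le_lt_trans (hardyA_le hv hw hp hq C0 hardy pq) _; rewrite ltry.
  by apply: le_lt_trans (hardyA_le_stieltjes hv hw hp hq C0 qp hardy) _; rewrite ltry.
have [M [M0 Mb]] := discrete_bound hv hw hp hq Aoo.
apply: (hardy_scaling hv hw hp hq (K := (4 `^ q * M)%R)).
  by rewrite mulr_ge0 ?powR_ge0.
apply: hardy_normalized => // t t0 Wt.
exact: (hardyV_lty hv hw hp hq Aoo).
Qed.
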